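(* For every integer $r\ge 2$, $$\zeta(2r+1)=-\frac{(2^{2r-1}-2)\pi^2}{r(2r-1)(2^{4r+1}+2^{2r}-1)}\zeta(2r-1)+\frac{2^{4r+1}}{r(2r-1)(2^{4r+1}+2^{2r}-1)}\left[\sum_{k=1}^{r-1}(-1)^{k-1}\frac{(r-k)(2r+2k-1)}{(2k)!}\left(\frac{\pi}{2}\right)^{2k}\zeta(2r+1-2k)+(-1)^r\left(\frac{\pi}{2}\right)^{2r}\sum_{k=0}^\infty\frac{(2k)!\,(4r+2k-1)}{(2r+2k)!}\frac{\zeta(2k)}{4^{2k}}\right].$$
   Context: $\zeta$ is the Riemann zeta function (analytically continued), so $\zeta(0)=-1/2$. An empty sum is zero. *)

(* Defs.v *)
From Stdlib Require Import Reals Lra Lia.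
From Coquelicot Require Import Coquelicot.
Open Scope R_scope.

(* The n-th term, n >= 0, of the Dirichlet series is (n + 1)^(-s). *)
Definition dirichlet_term (s : R) (n : nat) : R := Rpower (INR n + 1) (- s).

(* Hasse's globally convergent series for the analytic continuation of the
   Riemann zeta function, valid at every real s <> 1:
     zeta(s) = 1/(1 - 2^(1-s))
       * sum_(n >= 0) 2^(-n-1) * sum_(k = 0..n) (-1)^k binom(n,k) (k+1)^(-s). *)
Definition zeta_continued (s : R) : R :=
  / (1 - Rpower 2 (1 - s)) *
  Series (fun n : nat => / 2 ^ (n + 1) *
    sum_n (fun k : nat => (-1) ^ k * Binomial.C n k * dirichlet_term s k) n).

(* The Riemann zeta function on the real line; the value at the pole s = 1 is
   meaningless.  [zeta_continuedE] below shows that the two branches are given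
   by a single formula. *)
Definition zeta (s : R) : R :=
  if Rlt_dec 1 s then Series (dirichlet_term s) else zeta_continued s.

Lemma dirichlet_term_gt0 s n : 0 < dirichlet_term s n.
Proof. apply exp_pos. Qed.

Lemma dirichlet_term_decr s n : 0 <= s ->
  dirichlet_term s (S n) <= dirichlet_term s n.
Proof.
intros Hs; unfold dirichlet_term; rewrite !Rpower_Ropp.
apply Rinv_le_contravar; [apply exp_pos|].
pose proof (pos_INR n).
apply Rle_Rpower_l; [lra|]; rewrite S_INR; lra.
Qed.

Lemma dirichlet_term_0 s : dirichlet_term s 0 = 1.
Proof.
unfold dirichlet_term; simpl; unfold Rpower.
replace (0 + 1) with 1 by ring; rewrite ln_1, Rmult_0_r; apply exp_0.
Qed.

Lemma dirichlet_term_le s n : 1 <= s -> dirichlet_term s n <= / (INR n + 1).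
Proof.
intros Hs; unfold dirichlet_term; rewrite Rpower_Ropp.
pose proof (pos_INR n).
apply Rinv_le_contravar; [lra|].
rewrite <- (Rpower_1 (INR n + 1)) at 1 by lra.
apply Rle_Rpower; lra.
Qed.

Lemma dirichlet_term_odd s n :
  dirichlet_term s (2 * n + 1) = Rpower 2 (- s) * dirichlet_term s n.
Proof.
unfold dirichlet_term; pose proof (pos_INR n).
rewrite Rpower_mult_distr by lra; f_equal.
rewrite plus_INR, mult_INR; simpl; ring.
Qed.

Lemma Rpower2_mul s : 2 * Rpower 2 (- s) = Rpower 2 (1 - s).
Proof.
unfold Rminus; rewrite Rpower_plus, Rpower_1 by lra; reflexivity.
Qed.

Lemma Rpower2_lt1 s : 1 < s -> Rpower 2 (1 - s) < 1.
Proof.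
intros Hs; apply Rlt_le_trans with (Rpower 2 0).
- apply Rpower_lt; lra.
- rewrite Rpower_O; lra.
Qed.

Lemma dirichlet_sum_le s N : 1 < s ->
  sum_f_R0 (dirichlet_term s) N <= / (1 - Rpower 2 (1 - s)).
Proof.
intros Hs.
pose proof (Rpower2_lt1 s Hs) as Hq.
assert (H1 : sum_f_R0 (dirichlet_term s) (2 * N + 1) + dirichlet_term s (2 * N + 1)
  <= 1 + Rpower 2 (1 - s) * sum_f_R0 (dirichlet_term s) N).
{ induction N as [|N IH].
  - simpl sum_f_R0. pose proof (dirichlet_term_odd s 0) as H; simpl in H.
    simpl; rewrite H, dirichlet_term_0, <- (Rpower2_mul s); lra.
  - replace (2 * S N + 1)%nat with (S (S (2 * N + 1))) by lia.
    rewrite !tech5.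
    pose proof (dirichlet_term_odd s (S N)) as H.
    replace (2 * S N + 1)%nat with (S (S (2 * N + 1))) in H by lia.
    pose proof (dirichlet_term_decr s (2 * N + 1) ltac:(lra)).
    rewrite H, Rmult_plus_distr_l, <- (Rpower2_mul s) in *; lra. }
assert (H2 : sum_f_R0 (dirichlet_term s) N <= sum_f_R0 (dirichlet_term s) (2 * N + 1)).
{ destruct (Nat.eq_dec N (2 * N + 1)) as [E|E]; [lia|].
  rewrite (tech2 (dirichlet_term s) N (2 * N + 1)) by lia.
  assert (0 <= sum_f_R0 (fun i => dirichlet_term s (S N + i)) (2 * N + 1 - S N)).
  { apply cond_pos_sum; intros; left; apply dirichlet_term_gt0. }
  lra. }
pose proof (dirichlet_term_gt0 s (2 * N + 1)).
apply Rmult_le_reg_l with (1 - Rpower 2 (1 - s)); [lra|].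
rewrite Rinv_r by lra; lra.
Qed.

Lemma ex_series_dirichlet s : 1 < s -> ex_series (dirichlet_term s).
Proof.
intros Hs.
destruct (ex_finite_lim_seq_incr (sum_n (dirichlet_term s))
  (/ (1 - Rpower 2 (1 - s)))) as [l Hl].
- intros n; rewrite sum_Sn; unfold plus; simpl.
  pose proof (dirichlet_term_gt0 s (S n)); lra.
- intros n; rewrite sum_n_Reals; apply dirichlet_sum_le; lra.
- exists l; exact Hl.
Qed.

Lemma sum_pascal (g : nat -> R) n :
  sum_f_R0 (fun k => Binomial.C (S n) k * g k) (S n) =
  sum_f_R0 (fun k => Binomial.C n k * g k) n +
  sum_f_R0 (fun k => Binomial.C n k * g (S k)) n.
Proof.
assert (HC0 : forall m, Binomial.C m 0 = 1).
{ intros m; unfold Binomial.C; rewrite Nat.sub_0_r; simpl; field; apply INR_fact_neq_0. }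
assert (HCn : forall m, Binomial.C m m = 1).
{ intros m; unfold Binomial.C; rewrite Nat.sub_diag; simpl; field; apply INR_fact_neq_0. }
destruct n as [|n].
- simpl; rewrite !HC0, !HCn; ring.
- rewrite tech5, decomp_sum by lia; simpl pred.
  rewrite (decomp_sum (fun k => Binomial.C (S n) k * g k)) by lia; simpl pred.
  rewrite (tech5 (fun k => Binomial.C (S n) k * g (S k))).
  rewrite !HC0, !HCn.
  replace (sum_f_R0 (fun i => Binomial.C (S (S n)) (S i) * g (S i)) n) with
    (sum_f_R0 (fun i => Binomial.C (S n) (S i) * g (S i)) n +
     sum_f_R0 (fun k => Binomial.C (S n) k * g (S k)) n).
  + ring.
  + rewrite <- sum_plus; apply sum_eq; intros i Hi.
    rewrite <- (pascal (S n) i) by lia; ring.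
Qed.

Lemma sum_binomial_inv n :
  sum_f_R0 (fun k => Binomial.C n k * / (INR k + 1)) n <= 2 ^ (S n) / (INR n + 1).
Proof.
pose proof (pos_INR n).
assert (E : 2 ^ S n = sum_f_R0 (fun k => Binomial.C (S n) k) (S n)).
{ replace 2 with (1 + 1) by ring; rewrite binomial; apply sum_eq.
  intros i _; rewrite !pow1; ring. }
rewrite decomp_sum in E by lia; simpl pred in E.
assert (0 <= Binomial.C (S n) 0).
{ unfold Binomial.C; apply Rle_div_r; [|rewrite Rmult_0_l; apply pos_INR].
  apply Rmult_lt_0_compat; apply INR_fact_lt_0. }
replace (sum_f_R0 (fun k => Binomial.C n k * / (INR k + 1)) n) with
  (sum_f_R0 (fun k => Binomial.C (S n) (S k)) n * / (INR n + 1)).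
- rewrite E; unfold Rdiv; apply Rmult_le_compat_r; [|lra].
  left; apply Rinv_0_lt_compat; lra.
- rewrite Rmult_comm, scal_sum; apply sum_eq; intros i Hi.
  pose proof (pos_INR i).
  unfold Binomial.C; replace (S n - S i)%nat with (n - i)%nat by lia.
  rewrite !fact_simpl, !mult_INR, !S_INR.
  field; repeat split; try apply INR_fact_neq_0; lra.
Qed.

Lemma is_series_alternating_bounds (u : nat -> R) l :
  (forall n, u (S n) <= u n) -> is_lim_seq u 0 ->
  is_series (fun k => (-1) ^ k * u k) l -> 0 <= l <= u 0%nat.
Proof.
intros Hd H0 Hl.
destruct (alternated_series_ineq u l 0) as [Ha Hb].
- exact Hd.
- apply is_lim_seq_Reals; exact H0.
- apply is_lim_seq_Reals.
  apply is_lim_seq_ext with (2 := Hl).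
  intros n; rewrite sum_n_Reals; reflexivity.
- unfold tg_alt in *; simpl in *.
  pose proof (Hd 0%nat); lra.
Qed.

(* Euler's transformation of the alternating series of [dirichlet_term s]. *)
Lemma is_series_hasse s : 1 < s ->
  is_series (fun n : nat => / 2 ^ (n + 1) *
    sum_n (fun k : nat => (-1) ^ k * Binomial.C n k * dirichlet_term s k) n)
   (Series (fun k => (-1) ^ k * dirichlet_term s k)).
Proof.
intros Hs.
set (a := dirichlet_term s).
assert (Hex : forall m, ex_series (fun k => (-1) ^ k * a (m + k)%nat)).
{ intros m; apply ex_series_Rabs.
  apply ex_series_ext with (fun k => a (m + k)%nat).
  - intros k; rewrite Rabs_mult, pow_1_abs, Rmult_1_l.
    symmetry; apply Rabs_pos_eq; left; apply dirichlet_term_gt0.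
  - apply (ex_series_incr_n a m), ex_series_dirichlet, Hs. }
set (b := fun m => Series (fun k => (-1) ^ k * a (m + k)%nat)).
assert (Hb : forall m, a m = b m + b (S m)).
{ intros m; unfold b at 1; rewrite Series_incr_1 by apply Hex.
  rewrite Nat.add_0_r.
  rewrite (Series_ext _ (fun k => (-1) * ((-1) ^ k * a (S m + k)%nat))).
  - rewrite Series_scal_l; fold (b (S m)); simpl; ring.
  - intros k; rewrite <- plus_n_Sm, Nat.add_succ_l; simpl; ring. }
assert (Ha0 : is_lim_seq a 0) by apply ex_series_lim_0, ex_series_dirichlet, Hs.
assert (Hbb : forall m, Rabs (b m) <= / (INR m + 1)).
{ intros m.
  destruct (is_series_alternating_bounds (fun k => a (m + k)%nat) (b m)) as [H1 H2].
  - intros n; rewrite <- plus_n_Sm; apply dirichlet_term_decr; lra.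
  - apply is_lim_seq_ext with (fun k => a (k + m)%nat).
    { intros k; f_equal; lia. }
    apply -> is_lim_seq_incr_n; exact Ha0.
  - apply Series_correct, Hex.
  - rewrite Rabs_pos_eq by exact H1; rewrite Nat.add_0_r in H2.
    apply Rle_trans with (1 := H2), dirichlet_term_le; lra. }
set (e := fun n => / 2 ^ n *
  sum_f_R0 (fun k => Binomial.C n k * ((-1) ^ k * b k)) n).
assert (Hpart : forall N, sum_n (fun n => / 2 ^ (n + 1) *
    sum_n (fun k => (-1) ^ k * Binomial.C n k * a k) n) N = b 0%nat - e (S N)).
{ assert (Hstep : forall n, / 2 ^ (n + 1) *
    sum_n (fun k => (-1) ^ k * Binomial.C n k * a k) n = e n - e (S n)).
  { intros n; unfold e; rewrite sum_n_Reals, sum_pascal, Nat.add_1_r.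
    assert (E1 : sum_f_R0 (fun k => (-1) ^ k * Binomial.C n k * a k) n =
      sum_f_R0 (fun k => Binomial.C n k * ((-1) ^ k * b k)) n -
      sum_f_R0 (fun k => Binomial.C n k * ((-1) ^ S k * b (S k))) n).
    { rewrite <- minus_sum; apply sum_eq; intros i _; rewrite Hb; simpl; ring. }
    rewrite E1.
    assert (2 ^ n <> 0) by (apply pow_nonzero; lra).
    simpl; field; assumption. }
  intros N; induction N as [|N IH].
  - rewrite sum_O, Hstep; unfold e at 1; simpl.
    unfold Binomial.C; simpl; field.
  - rewrite sum_Sn, IH, Hstep; unfold plus; simpl; ring. }
assert (He : is_lim_seq e 0).
{ apply is_lim_seq_abs_0.
  apply is_lim_seq_le_le with (fun _ => 0) (fun n => 2 * / (INR n + 1)).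
  - intros n; split; [apply Rabs_pos|].
    assert (H2n : 0 < 2 ^ n) by (apply pow_lt; lra).
    unfold e; rewrite Rabs_mult, Rabs_pos_eq by (left; apply Rinv_0_lt_compat; lra).
    apply Rmult_le_reg_l with (2 ^ n); [lra|].
    rewrite <- Rmult_assoc, Rinv_r, Rmult_1_l by lra.
    apply Rle_trans with (1 := Rsum_abs _ _).
    apply Rle_trans with (sum_f_R0 (fun k => Binomial.C n k * / (INR k + 1)) n).
    + apply sum_Rle; intros k _.
      rewrite !Rabs_mult, pow_1_abs, Rmult_1_l, Rabs_pos_eq.
      * apply Rmult_le_compat_l; [|apply Hbb].
        unfold Binomial.C; apply Rle_div_r; [|rewrite Rmult_0_l; apply pos_INR].
        apply Rmult_lt_0_compat; apply INR_fact_lt_0.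
      * unfold Binomial.C; apply Rle_div_r; [|rewrite Rmult_0_l; apply pos_INR].
        apply Rmult_lt_0_compat; apply INR_fact_lt_0.
    + apply Rle_trans with (1 := sum_binomial_inv n).
      simpl; apply Req_le; unfold Rdiv; ring.
  - apply is_lim_seq_const.
  - replace (Finite 0) with (Rbar_mult 2 (Rbar_inv p_infty)) by (simpl; f_equal; ring).
    apply is_lim_seq_scal_l, is_lim_seq_inv; [|discriminate].
    apply is_lim_seq_ext with (fun n => INR (S n)); [intros; apply S_INR|].
    apply -> (is_lim_seq_incr_1 INR); apply is_lim_seq_INR. }
change (is_lim_seq (sum_n (fun n => / 2 ^ (n + 1) *
    sum_n (fun k => (-1) ^ k * Binomial.C n k * a k) n)) (b 0%nat)).
apply is_lim_seq_ext with (fun N => b 0%nat - e (S N)).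
{ intros N; symmetry; apply Hpart. }
replace (Finite (b 0%nat)) with (Finite (b 0%nat - 0)) by (f_equal; ring).
apply is_lim_seq_minus'; [apply is_lim_seq_const|].
apply -> is_lim_seq_incr_1; exact He.
Qed.

Lemma Series_dirichlet_alternating s : 1 < s ->
  Series (fun k => (-1) ^ k * dirichlet_term s k) =
  (1 - Rpower 2 (1 - s)) * Series (dirichlet_term s).
Proof.
intros Hs.
pose proof (Series_correct _ (ex_series_dirichlet s Hs)) as H.
assert (Halt : ex_series (fun k => (-1) ^ k * dirichlet_term s k)).
{ apply ex_series_Rabs.
  apply ex_series_ext with (dirichlet_term s); [|exact (ex_series_dirichlet s Hs)].
  intros k; rewrite Rabs_mult, pow_1_abs, Rmult_1_l.
  symmetry; apply Rabs_pos_eq; left; apply dirichlet_term_gt0. }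
apply Series_correct in Halt.
set (l := Series (fun k => (-1) ^ k * dirichlet_term s k)) in *.
set (z := Series (dirichlet_term s)) in *.
change (is_lim_seq (sum_n (dirichlet_term s)) z) in H.
change (is_lim_seq (sum_n (fun k => (-1) ^ k * dirichlet_term s k)) l) in Halt.
assert (Hsub : forall u (x : R), is_lim_seq u x ->
  is_lim_seq (fun n => u (2 * n + 1)%nat) x).
{ intros u x Hu; apply (is_lim_seq_subseq u x (fun n => (2 * n + 1)%nat)); [|exact Hu].
  apply eventually_subseq; intros n; lia. }
assert (E : forall n, sum_n (fun k => (-1) ^ k * dirichlet_term s k) (2 * n + 1) =
  sum_n (dirichlet_term s) (2 * n + 1)
  - Rpower 2 (1 - s) * sum_n (dirichlet_term s) n).
{ intros n; rewrite !sum_n_Reals; induction n as [|n IH].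
  - pose proof (dirichlet_term_odd s 0) as H1; simpl in H1.
    simpl; rewrite H1, <- (Rpower2_mul s); ring.
  - pose proof (dirichlet_term_odd s (S n)) as H1.
    assert (E1 : (2 * S n + 1 = S (S (2 * n + 1)))%nat) by lia.
    rewrite E1 in *; rewrite !tech5, IH, H1, <- (Rpower2_mul s).
    assert (E2 : (-1) ^ S (2 * n + 1) = 1).
    { replace (S (2 * n + 1)) with (2 * S n)%nat by lia; apply pow_1_even. }
    assert (E3 : (-1) ^ S (S (2 * n + 1)) = -1).
    { rewrite <- tech_pow_Rmult, E2; ring. }
    rewrite E2, E3; match goal with |- ?x = ?y => change (@eq R x y) end; ring. }
assert (Hlim : is_lim_seq (fun n => sum_n (fun k => (-1) ^ k * dirichlet_term s k) (2 * n + 1))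
  (z - Rpower 2 (1 - s) * z)).
{ eapply is_lim_seq_ext; [intros n; symmetry; apply E|].
  apply is_lim_seq_minus'; [apply (Hsub _ _ H)|].
  apply (is_lim_seq_scal_l _ (Rpower 2 (1 - s)) z H). }
pose proof (is_lim_seq_unique _ _ (Hsub _ _ Halt)) as U1.
pose proof (is_lim_seq_unique _ _ Hlim) as U2.
rewrite U1 in U2; injection U2 as U2; rewrite U2; ring.
Qed.

Lemma zeta_continuedE s : s <> 1 -> zeta s = zeta_continued s.
Proof.
intros Hs1; unfold zeta; destruct (Rlt_dec 1 s) as [Hs|Hs]; [|reflexivity].
unfold zeta_continued.
rewrite (is_series_unique _ _ (is_series_hasse s Hs)).
rewrite Series_dirichlet_alternating by exact Hs.
pose proof (Rpower2_lt1 s Hs); field; lra.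
Qed.

Lemma zeta_0 : zeta 0 = - (1 / 2).
Proof.
rewrite zeta_continuedE by lra; unfold zeta_continued.
rewrite Rminus_0_r, Rpower_1 by lra.
assert (Hin : forall n, sum_n (fun k => (-1) ^ k * Binomial.C n k * dirichlet_term 0 k) n
  = (1 + -1) ^ n).
{ intros n; rewrite sum_n_Reals, (Rplus_comm 1), binomial; apply sum_eq; intros i _.
  assert (dirichlet_term 0 i = 1) as ->.
  { unfold dirichlet_term; rewrite Ropp_0; apply Rpower_O; pose proof (pos_INR i); lra. }
  rewrite pow1; ring. }
rewrite (is_series_unique _ (/ 2)).
- field.
- match goal with |- is_series ?u _ => change (is_lim_seq (sum_n u) (/ 2)) end.
  apply is_lim_seq_ext with (fun _ => / 2); [|apply is_lim_seq_const].
  intros n; induction n as [|n IH].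
  + rewrite sum_O, Hin; simpl; field.
  + rewrite sum_Sn, <- IH, Hin.
    replace (1 + -1) with 0 by ring; rewrite pow_i by lia.
    unfold plus; simpl; ring.
Qed.

(* Main.v *)
Require Import Defs.
From Stdlib Require Import Reals Factorial Lra Lia.
From Coquelicot Require Import Coquelicot.
Open Scope R_scope.

(* Write w(u) = (1-u)^(2r-2) (2-u) / (2r-2)!.  The coefficient of
   zeta(2k) / 4^(2k) in the infinite series is the moment int_0^1 w(u) u^(2k) du,
   so the series equals J = int_0^1 w(u) Z(u/4) du, where
   Z(z) = sum_k zeta(2k) z^(2k) = -(pi z / 2) cot(pi z) by the partial fraction
   expansion of the cotangent.  With t = pi u / 2, the conjugate Dirichlet kernel
   turns (1/2) cot(t/2) into sum_(n >= 1) sin(n t) under the integral, and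
   u w(u) = ((1-u)^(2r-2) - (1-u)^(2r)) / (2r-2)!, so J becomes the sum over n of
   sine moments of powers of 1-u.  These moments are Taylor remainders of the
   cosine at a = n pi / 2 divided by odd powers of a; the 1/a terms cancel,
   and summing the others over n gives the odd zeta values. *)

(** * A Riemann-Lebesgue lemma *)

(** The sine series behind the cotangent diverges pointwise, so it is never summed under the
    integral. Only its partial sums are used: their closed form consists of the cotangent and an
    oscillating remainder over a sine, and the integral of the remainder tends to 0 because the
    factor in front of it vanishes at [u = 0] as fast as that sine. The same device proves the
    cotangent expansion itself. The 1/a terms have to cancel because their sum over n would be a
    multiple of the divergent zeta(1). Sampling at a = n pi / 2 also leaves cosine values, which
    vanish for odd n and alternate for even n; they give alternating zeta values at 2r+1 and 2r-1.
    The first is where the denominator comes from, since 1 + 2^(-2r-1) (1 - 2^(-2r)) = (2^(4r+1) +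
    2^(2r) - 1) / 2^(4r+1); the second is the isolated zeta(2r-1) term. *)

(** Any linear lower bound would serve: x - x^3/6 >= x/3 holds as soon as x <= 2, and this follows
    from the crude [PI <= 4]. *)
Lemma sin_ge_third x : 0 <= x <= PI / 2 -> x / 3 <= sin x.
Proof.
intros Hx.
pose proof PI_4; pose proof PI_RGT_0.
destruct (sin_bound x 0) as [H1 _]; try lra.
unfold sin_approx, sin_term in H1; simpl in H1.
apply Rle_trans with (2 := H1).
assert (x * x <= 4) by nra.
nra.
Qed.

(* [N u / sin (c * u)] is bounded on (0, 1] but need not be differentiable at 0:
   integrate by parts on [d, 1] and bound the integral over [0, d] trivially. *)
Lemma riemann_lebesgue (c e K : R) (N dN : R -> R) (lam : nat -> R)
  (f : nat -> R -> R) :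
  0 < c <= PI / 2 ->
  (forall u, is_derive N u (dN u)) ->
  (forall u, continuous dN u) ->
  (forall u, 0 <= u <= 1 -> Rabs (N u) <= K * u) ->
  is_lim_seq lam p_infty ->
  (forall n u, 0 <= u <= 1 -> continuous (f n) u) ->
  (forall n u, 0 < u < 1 ->
     f n u = N u / sin (c * u) * sin (lam n * u + e)) ->
  is_lim_seq (fun n => RInt (f n) 0 1) 0.
Proof.
intros Hc HN HdN HK Hlam Hf Hfe.
pose proof PI_RGT_0.
assert (HK0 : 0 <= K).
{ pose proof (HK 1 ltac:(lra)); pose proof (Rabs_pos (N 1)); lra. }
set (g := fun u => N u / sin (c * u)).
set (dg := fun u => (dN u * sin (c * u) - N u * (c * cos (c * u))) / sin (c * u) ^ 2).
(* Quotient of the bound [K * u] on the numerator by the lower bound [c * u / 3] on the sine. *)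
set (B := 3 * K / c).
assert (HB0 : 0 <= B).
{ unfold B; apply Rdiv_le_0_compat; lra. }
assert (Hs : forall u, 0 < u <= 1 -> 0 < c * u / 3 <= sin (c * u)).
{ intros u Hu; split; [nra|]; apply sin_ge_third; nra. }
assert (HgB : forall u, 0 < u <= 1 -> Rabs (g u) <= B).
{ intros u Hu; destruct (Hs u Hu) as [H1 H2].
  unfold g, Rdiv; rewrite Rabs_mult, Rabs_inv, (Rabs_pos_eq (sin (c * u))) by lra.
  apply Rle_div_l; [lra|].
  apply Rle_trans with (1 := HK u ltac:(lra)).
  apply Rle_trans with (B * (c * u / 3)); [|apply Rmult_le_compat_l; lra].
  apply Req_le; unfold B; field; lra. }
assert (Hdg : forall u, 0 < u <= 1 -> is_derive g u (dg u)).
{ intros u Hu; destruct (Hs u Hu) as [H1 H2]; unfold g, dg.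
  evar_last.
  - apply is_derive_div; [apply HN| |lra].
    instantiate (1 := c * cos (c * u)); auto_derive; [exact I|ring].
  - reflexivity. }
assert (Hdgc : forall u, 0 < u <= 1 -> continuous dg u).
{ intros u Hu; destruct (Hs u Hu) as [H1 H2]; unfold dg, Rdiv.
  apply (continuous_mult (fun u => dN u * sin (c * u) - N u * (c * cos (c * u)))
           (fun u => / sin (c * u) ^ 2)).
  - apply (continuous_minus (fun u => dN u * sin (c * u)) (fun u => N u * (c * cos (c * u)))).
    + apply (continuous_mult dN (fun u => sin (c * u))); [apply HdN|].
      apply (ex_derive_continuous (fun u => sin (c * u))); auto_derive; exact I.
    + apply (continuous_mult N (fun u => c * cos (c * u))).
      * apply (ex_derive_continuous N); eexists; apply HN.
      * apply (ex_derive_continuous (fun u => c * cos (c * u))); auto_derive; exact I.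
  - apply (ex_derive_continuous (fun u => / sin (c * u) ^ 2)); auto_derive.
    apply Rgt_not_eq; nra. }
assert (Hfi : forall n a b, 0 <= a <= 1 -> 0 <= b <= 1 -> ex_RInt (f n) a b).
{ intros n a b Ha Hb; apply (ex_RInt_continuous (f n)).
  intros x Hx; apply Hf; revert Hx; unfold Rmin, Rmax; destruct (Rle_dec a b); lra. }
apply is_lim_seq_Reals; intros eps Heps.
(* Chosen so that [B * d < eps / 2], which bounds the integral over [[0, d]]; the [+ 1] guards
   against [B = 0]. *)
set (d := Rmin 1 (eps / (2 * (B + 1)))).
assert (Hd : 0 < d <= 1).
{ unfold d; split; [apply Rmin_glb_lt; [lra|]|apply Rmin_l].
  apply Rdiv_lt_0_compat; lra. }
assert (HdB : B * d < eps / 2).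
{ assert (d <= eps / (2 * (B + 1))) by apply Rmin_r.
  apply Rle_lt_trans with (B * (eps / (2 * (B + 1)))); [apply Rmult_le_compat_l; lra|].
  apply Rmult_lt_reg_l with (2 * (B + 1)); [lra|].
  replace (2 * (B + 1) * (B * (eps / (2 * (B + 1))))) with (B * eps) by (field; lra).
  nra. }
destruct (bounded_continuity dg d 1) as [D HD].
{ intros u Hu; apply Hdgc; lra. }
assert (HD0 : 0 <= D).
{ pose proof (HD 1 ltac:(lra)); pose proof (norm_ge_0 (dg 1)); lra. }
apply is_lim_seq_spec in Hlam.
(* After integration by parts on [[d, 1]] the two boundary terms cost [2 * B / l] and the remaining
   integral at most [D / l]. *)
destruct (Hlam (Rmax 0 ((2 * B + D) / (eps / 2)))) as [n0 Hn0].
exists n0; intros n Hn; unfold Rdist; rewrite Rminus_0_r.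
specialize (Hn0 n Hn).
set (l := lam n) in *.
assert (Hl : 0 < l) by (apply Rle_lt_trans with (2 := Hn0), Rmax_l).
assert (Hl2 : (2 * B + D) / l < eps / 2).
{ assert (Hn1 : (2 * B + D) / (eps / 2) < l) by (apply Rle_lt_trans with (2 := Hn0), Rmax_r).
  apply Rlt_div_l in Hn1; [|lra].
  apply Rlt_div_l; lra. }
rewrite <- (RInt_Chasles (f n) 0 d 1) by (apply Hfi; lra).
assert (Hfb : forall u, 0 < u < 1 -> Rabs (f n u) <= B).
{ intros u Hu; rewrite Hfe by exact Hu; fold l; rewrite Rabs_mult.
  pose proof (HgB u ltac:(lra)) as Hg; unfold g in Hg.
  pose proof (SIN_bound (l * u + e)).
  assert (Rabs (sin (l * u + e)) <= 1) by (apply Rabs_le; lra).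
  pose proof (Rabs_pos (N u / sin (c * u))).
  pose proof (Rabs_pos (sin (l * u + e))). nra. }
assert (H0d : Rabs (RInt (f n) 0 d) <= B * d).
{ assert (Hc1 : forall C, RInt (fun _ => C) 0 d = C * d).
  { intros C; rewrite RInt_const; unfold scal; simpl; unfold mult; simpl; ring. }
  apply Rabs_le; split.
  - rewrite <- Ropp_mult_distr_l_reverse, <- Hc1.
    apply RInt_le; [lra|apply ex_RInt_const|apply Hfi; lra|].
    intros u Hu; pose proof (Hfb u ltac:(lra)) as Hb; apply Rabs_le_between in Hb; lra.
  - rewrite <- Hc1.
    apply RInt_le; [lra|apply Hfi; lra|apply ex_RInt_const|].
    intros u Hu; pose proof (Hfb u ltac:(lra)) as Hb; apply Rabs_le_between in Hb; lra. }
set (G := fun u => - / l * (g u * cos (l * u + e))).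
set (h := fun u => dg u * cos (l * u + e) / l).
assert (Hh : ex_RInt h d 1).
{ apply (ex_RInt_continuous h); intros x; rewrite Rmin_left, Rmax_right by lra; intros Hx.
  unfold h, Rdiv. apply (continuous_mult (fun u => dg u * cos (l * u + e)) (fun _ => / l)).
  - apply (continuous_mult dg (fun u => cos (l * u + e))); [apply Hdgc; lra|].
    apply (ex_derive_continuous (fun u => cos (l * u + e))); auto_derive; exact I.
  - apply continuous_const. }
assert (Hparts : is_RInt (fun u => g u * sin (l * u + e) - h u) d 1 (G 1 - G d)).
{ apply (is_RInt_derive G).
  - intros x; rewrite Rmin_left, Rmax_right by lra; intros Hx.
    unfold G, h.
    pose proof (Hdg x ltac:(lra)) as Hgx.
    evar_last.
    + apply (is_derive_scal (fun u => g u * cos (l * u + e)) x (- / l)).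
      apply (is_derive_mult g (fun u => cos (l * u + e))); [exact Hgx| |intros; apply Rmult_comm].
      instantiate (1 := - (l * sin (l * x + e))); auto_derive; [exact I|ring].
    + unfold plus, mult; simpl; field; lra.
  - intros x; rewrite Rmin_left, Rmax_right by lra; intros Hx.
    apply (continuous_minus (fun u => g u * sin (l * u + e)) h).
    + apply (continuous_mult g (fun u => sin (l * u + e))).
      * apply (ex_derive_continuous g); eexists; apply Hdg; lra.
      * apply (ex_derive_continuous (fun u => sin (l * u + e))); auto_derive; exact I.
    + unfold h, Rdiv. apply (continuous_mult (fun u => dg u * cos (l * u + e)) (fun _ => / l)).
      * apply (continuous_mult dg (fun u => cos (l * u + e))); [apply Hdgc; lra|].
        apply (ex_derive_continuous (fun u => cos (l * u + e))); auto_derive; exact I.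
      * apply continuous_const. }
assert (Hd1 : RInt (f n) d 1 = G 1 - G d + RInt h d 1).
{ apply is_RInt_unique.
  apply is_RInt_ext with (fun u => plus (g u * sin (l * u + e) - h u) (h u)).
  - intros u; rewrite Rmin_left, Rmax_right by lra; intros Hu.
    rewrite Hfe by lra; unfold plus, g; simpl; fold l; ring.
  - apply (is_RInt_plus (fun u => g u * sin (l * u + e) - h u) h); [exact Hparts|].
    exact (RInt_correct h d 1 Hh). }
assert (HG : forall u, 0 < u <= 1 -> Rabs (G u) <= B / l).
{ intros u Hu; unfold G, Rdiv; rewrite Rabs_mult, Rabs_Ropp, Rabs_mult, Rabs_inv, (Rabs_pos_eq l) by lra.
  rewrite (Rmult_comm (/ l)).
  apply Rmult_le_compat_r; [left; apply Rinv_0_lt_compat; lra|].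
  pose proof (HgB u Hu); pose proof (COS_bound (l * u + e)).
  assert (Rabs (cos (l * u + e)) <= 1) by (apply Rabs_le; lra).
  pose proof (Rabs_pos (g u)); pose proof (Rabs_pos (cos (l * u + e))); nra. }
assert (Hhb : Rabs (RInt h d 1) <= D / l).
{ apply Rle_trans with ((1 - d) * (D / l)).
  - apply abs_RInt_le_const; [lra|exact Hh|].
    intros u Hu; unfold h, Rdiv; rewrite !Rabs_mult, Rabs_inv, (Rabs_pos_eq l) by lra.
    apply Rmult_le_compat_r; [left; apply Rinv_0_lt_compat; lra|].
    pose proof (HD u Hu) as H1; unfold norm in H1; simpl in H1; unfold abs in H1; simpl in H1.
    pose proof (COS_bound (l * u + e)).
    assert (Rabs (cos (l * u + e)) <= 1) by (apply Rabs_le; lra).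
    pose proof (Rabs_pos (dg u)); pose proof (Rabs_pos (cos (l * u + e))); nra.
  - assert (0 <= D / l) by (apply Rdiv_le_0_compat; lra). nra. }
rewrite Hd1; unfold plus; simpl.
pose proof (HG 1 ltac:(lra)) as HG1; pose proof (HG d Hd) as HGd.
apply Rabs_le_between in HG1; apply Rabs_le_between in HGd; apply Rabs_le_between in Hhb.
apply Rabs_le_between in H0d.
assert (E : (2 * B + D) / l = B / l + B / l + D / l) by (field; lra).
apply Rabs_def1; lra.
Qed.

(** * Partial fractions of the cotangent *)

Lemma is_RInt_Rext (f g : R -> R) a b (l : R) :
  (forall x, f x = g x) -> is_RInt f a b l -> is_RInt g a b l.
Proof. intros H; apply (is_RInt_ext (V := R_NormedModule)); intros x _; apply H. Qed.

Lemma is_RInt_Rplus (f g : R -> R) a b (lf lg : R) :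
  is_RInt f a b lf -> is_RInt g a b lg -> is_RInt (fun x => f x + g x) a b (lf + lg).
Proof. exact (is_RInt_plus (V := R_NormedModule) f g a b lf lg). Qed.

Lemma is_RInt_Rminus (f g : R -> R) a b (lf lg : R) :
  is_RInt f a b lf -> is_RInt g a b lg -> is_RInt (fun x => f x - g x) a b (lf - lg).
Proof. exact (is_RInt_minus (V := R_NormedModule) f g a b lf lg). Qed.

Lemma is_RInt_Rmult_l c (f : R -> R) a b (l : R) :
  is_RInt f a b l -> is_RInt (fun x => c * f x) a b (c * l).
Proof. exact (is_RInt_scal (V := R_NormedModule) f a b c l). Qed.

(** Telescopes through 2 sin x cos y = sin (y + x) - sin (y - x). The index k stands for the
    frequency k + 1, whence 2n + 3 where the usual kernel has 2n + 1. The form without division also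
    covers the zeros of the sine. *)
Lemma dirichlet_kernel_cos x n :
  sin x * (1 + 2 * sum_n (fun k => cos (2 * (INR k + 1) * x)) n) =
  sin ((2 * INR n + 3) * x).
Proof.
assert (H : forall y, 2 * sin x * cos y = sin (y + x) - sin (y - x)).
{ intros y; rewrite sin_plus, sin_minus; ring. }
induction n as [|n IH].
- rewrite sum_O; simpl INR.
  replace (sin x * (1 + 2 * cos (2 * (0 + 1) * x)))
    with (sin x + 2 * sin x * cos (2 * (0 + 1) * x)) by ring.
  rewrite H.
  replace (2 * (0 + 1) * x - x) with x by ring.
  replace (2 * (0 + 1) * x + x) with ((2 * 0 + 3) * x) by ring; ring.
- rewrite sum_Sn; change plus with Rplus.
  transitivity (sin ((2 * INR n + 3) * x) + 2 * sin x * cos (2 * (INR (S n) + 1) * x)).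
  { rewrite <- IH; ring. }
  rewrite H, S_INR.
  replace (2 * (INR n + 1 + 1) * x - x) with ((2 * INR n + 3) * x) by ring.
  replace (2 * (INR n + 1 + 1) * x + x) with ((2 * (INR n + 1) + 3) * x) by ring; ring.
Qed.

(** Telescopes likewise; the [cos x] left at the lower end becomes the cotangent after division by
    [sin x]. *)
Lemma dirichlet_kernel_sin x n :
  2 * sin x * sum_n (fun k => sin (2 * (INR k + 1) * x)) n =
  cos x - cos ((2 * INR n + 3) * x).
Proof.
assert (H : forall y, 2 * sin x * sin y = cos (y - x) - cos (y + x)).
{ intros y; rewrite cos_plus, cos_minus; ring. }
induction n as [|n IH].
- rewrite sum_O, H; simpl INR.
  replace (2 * (0 + 1) * x - x) with x by ring.
  replace (2 * (0 + 1) * x + x) with ((2 * 0 + 3) * x) by ring; ring.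
- rewrite sum_Sn; change plus with Rplus.
  rewrite Rmult_plus_distr_l, IH, H, S_INR.
  replace (2 * (INR n + 1 + 1) * x - x) with ((2 * INR n + 3) * x) by ring.
  replace (2 * (INR n + 1 + 1) * x + x) with ((2 * (INR n + 1) + 3) * x) by ring; ring.
Qed.

Lemma is_lim_seq_affine a b : 0 < a -> is_lim_seq (fun n => a * INR n + b) p_infty.
Proof.
intros Ha.
apply is_lim_seq_plus with p_infty b.
- apply is_lim_seq_mult with a p_infty.
  + apply is_lim_seq_const.
  + apply is_lim_seq_INR.
  + apply is_Rbar_mult_sym, is_Rbar_mult_p_infty_pos; exact Ha.
- apply is_lim_seq_const.
- reflexivity.
Qed.

Lemma sin_INR_PI n : sin (INR n * PI) = 0.
Proof. apply sin_eq_0_1; exists (Z.of_nat n); rewrite INR_IZR_INZ; reflexivity. Qed.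

Lemma is_RInt_sum_n (F : nat -> R -> R) (l : nat -> R) a b n :
  (forall k, is_RInt (F k) a b (l k)) ->
  is_RInt (fun x => sum_n (fun k => F k x) n) a b (sum_n l n).
Proof.
intros H; induction n as [|n IH].
- rewrite sum_O; apply is_RInt_ext with (F 0%nat); [|apply H].
  intros x _; rewrite sum_O; reflexivity.
- rewrite sum_Sn.
  apply is_RInt_ext with (fun x => plus (sum_n (fun k => F k x) n) (F (S n) x)).
  { intros x _; rewrite sum_Sn; reflexivity. }
  apply (is_RInt_plus (fun x => sum_n (fun k => F k x) n) (F (S n))); [exact IH|apply H].
Qed.

(** Fourier cosine coefficients of u -> cos (pi z (1 - u)); up to a common factor they are the
    partial fractions of the cotangent. *)
Lemma is_RInt_cos_mult_cos z n : 0 < z < 1 ->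
  is_RInt (fun u => cos (PI * z * (1 - u)) * cos ((INR n + 1) * PI * u)) 0 1
    (- (z * sin (PI * z)) / (PI * ((INR n + 1) ^ 2 - z ^ 2))).
Proof.
intros Hz; pose proof (pos_INR n); pose proof PI_RGT_0.
set (m := INR n + 1).
(* Antiderivative by the product-to-sum formula. At [u = 1] both arguments are integer multiples of
   [PI], so only [u = 0] contributes. *)
set (F := fun u => / (2 * PI) * (sin (PI * z + (m - z) * PI * u) / (m - z)
                       - sin (PI * z - (m + z) * PI * u) / (m + z))).
assert (Hm : 1 <= m) by (unfold m; lra).
evar_last.
- apply (is_RInt_derive F).
  + intros u _; unfold F; auto_derive; [exact I|].
    replace (PI * z * (1 - u)) with (PI * z - PI * z * u) by ring.
    replace (PI * z + (m - z) * PI * u) with ((PI * z - PI * z * u) + m * PI * u) by ring.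
    replace (PI * z + - ((m + z) * PI * u)) with ((PI * z - PI * z * u) - m * PI * u) by ring.
    rewrite (cos_plus (PI * z - PI * z * u)), (cos_minus (PI * z - PI * z * u)).
    field; lra.
  + intros u _; apply (ex_derive_continuous (fun u => cos (PI * z * (1 - u)) * cos (m * PI * u))).
    auto_derive; exact I.
- unfold F, minus, plus, opp; simpl.
  replace (PI * z + (m - z) * PI * 1) with (INR (S n) * PI) by (rewrite S_INR; unfold m; ring).
  replace (PI * z - (m + z) * PI * 1) with (- (INR (S n) * PI)) by (rewrite S_INR; unfold m; ring).
  rewrite sin_neg, sin_INR_PI, !Rmult_0_r, Rplus_0_r, Rminus_0_r.
  field; nra.
Qed.

Lemma Rabs_cos_minus_le a b : Rabs (cos a - cos b) <= Rabs (a - b).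
Proof.
destruct (MVT_abs cos (fun x => - sin x) b a) as [c [Hc _]].
{ intros c _; apply derivable_pt_lim_cos. }
rewrite Hc, Rabs_Ropp.
assert (Rabs (sin c) <= 1) by (apply Rabs_le, SIN_bound).
pose proof (Rabs_pos (a - b)); nra.
Qed.

(** This is the convergence at u = 0 of the Fourier cosine series of cos (pi z (1 - u)). Subtracting
    its value cos (pi z) at 0 makes [N] vanish there, which compensates the zero of sin (pi u / 2)
    in the Dirichlet kernel. Integrated term by term, [N] times the kernel is a fixed multiple of
    the limit minus the partial sum, and it tends to 0. *)
Lemma is_series_cot z : 0 < z < 1 ->
  is_series (fun n => 2 * z ^ 2 / ((INR n + 1) ^ 2 - z ^ 2))
    (1 - PI * z * cos (PI * z) / sin (PI * z)).
Proof.
intros Hz; pose proof PI_RGT_0.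
assert (Hs : 0 < sin (PI * z)) by (apply sin_gt_0; nra).
set (N := fun u => cos (PI * z * (1 - u)) - cos (PI * z)).
set (f := fun n u => N u * (1 + 2 * sum_n (fun k => cos ((INR k + 1) * PI * u)) n)).
assert (HRL : is_lim_seq (fun n => RInt (f n) 0 1) 0).
{ apply (riemann_lebesgue (PI / 2) 0 (PI * z) N (fun u => PI * z * sin (PI * z * (1 - u)))
           (fun n => PI * INR n + 3 * PI / 2)).
  - lra.
  - intros u; unfold N; auto_derive; [exact I|unfold Rminus; ring].
  - intros u; apply (ex_derive_continuous (fun u => PI * z * sin (PI * z * (1 - u)))).
    auto_derive; exact I.
  - intros u Hu; apply Rle_trans with (1 := Rabs_cos_minus_le _ _).
    replace (PI * z * (1 - u) - PI * z) with (- (PI * z * u)) by ring.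
    rewrite Rabs_Ropp, Rabs_pos_eq; [lra|].
    apply Rmult_le_pos; nra.
  - apply is_lim_seq_affine; lra.
  - intros n u _; unfold f.
    apply (continuous_mult N (fun u => 1 + 2 * sum_n (fun k => cos ((INR k + 1) * PI * u)) n)).
    + apply (ex_derive_continuous N); unfold N; auto_derive; exact I.
    + apply (continuous_plus (fun _ => 1) (fun u => 2 * sum_n (fun k => cos ((INR k + 1) * PI * u)) n)).
      * apply continuous_const.
      * apply (continuous_scal_r 2 (fun u => sum_n (fun k => cos ((INR k + 1) * PI * u)) n)).
        induction n as [|n IH].
        -- apply continuous_ext with (fun u => cos ((INR 0 + 1) * PI * u)).
           { intros v; rewrite sum_O; reflexivity. }
           apply (ex_derive_continuous (fun u => cos ((INR 0 + 1) * PI * u))); auto_derive; exact I.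
        -- apply continuous_ext with (fun v => plus (sum_n (fun k => cos ((INR k + 1) * PI * v)) n)
             (cos ((INR (S n) + 1) * PI * v))).
           { intros v; rewrite sum_Sn; reflexivity. }
           apply (continuous_plus _ (fun v => cos ((INR (S n) + 1) * PI * v))); [exact IH|].
           apply (ex_derive_continuous (fun u => cos ((INR (S n) + 1) * PI * u))).
           auto_derive; exact I.
  - intros n u Hu; unfold f.
    assert (Hsu : 0 < sin (PI / 2 * u)) by (apply sin_gt_0; nra).
    replace ((PI * INR n + 3 * PI / 2) * u + 0) with ((2 * INR n + 3) * (PI / 2 * u)) by field.
    rewrite <- dirichlet_kernel_cos.
    rewrite (sum_n_ext (fun k => cos (2 * (INR k + 1) * (PI / 2 * u)))
                       (fun k => cos ((INR k + 1) * PI * u))).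
    + field; lra.
    + intros k; f_equal; field. }
assert (HI : forall n, RInt (f n) 0 1 = sin (PI * z) / (PI * z) *
  (1 - PI * z * cos (PI * z) / sin (PI * z)
   - sum_n (fun n => 2 * z ^ 2 / ((INR n + 1) ^ 2 - z ^ 2)) n)).
{ intros n; apply is_RInt_unique.
  assert (H0 : is_RInt N 0 1 (sin (PI * z) / (PI * z) - cos (PI * z))).
  { evar_last.
    - apply (is_RInt_derive (fun u => - sin (PI * z * (1 - u)) / (PI * z) - cos (PI * z) * u)).
      + intros u _; unfold N; auto_derive; [exact I|unfold Rminus; field; nra].
      + intros u _; apply (ex_derive_continuous N); unfold N; auto_derive; exact I.
    - unfold minus, plus, opp; simpl.
      replace (PI * z * (1 - 1)) with 0 by ring.
      replace (PI * z * (1 - 0)) with (PI * z) by ring.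
      rewrite sin_0; field; nra. }
  assert (H1 : forall k, is_RInt (fun u => 2 * (N u * cos ((INR k + 1) * PI * u))) 0 1
     (- (sin (PI * z) / (PI * z)) * (2 * z ^ 2 / ((INR k + 1) ^ 2 - z ^ 2)))).
  { intros k; pose proof (pos_INR k).
    assert (Hc : is_RInt (fun u => cos ((INR k + 1) * PI * u)) 0 1 0).
    { evar_last.
      - apply (is_RInt_derive (fun u => sin ((INR k + 1) * PI * u) / ((INR k + 1) * PI))).
        + intros u _; auto_derive; [exact I|field; nra].
        + intros u _; apply (ex_derive_continuous (fun u => cos ((INR k + 1) * PI * u))).
          auto_derive; exact I.
      - unfold minus, plus, opp; simpl.
        rewrite !Rmult_0_r, Rmult_1_r, <- S_INR, sin_INR_PI, sin_0; unfold Rdiv; ring. }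
    evar_last.
    - apply is_RInt_ext with (fun u => scal 2
         (minus (cos (PI * z * (1 - u)) * cos ((INR k + 1) * PI * u))
                (scal (cos (PI * z)) (cos ((INR k + 1) * PI * u))))).
      { intros u _; unfold N, scal, minus, plus, opp; simpl; unfold mult; simpl; ring. }
      apply (is_RInt_scal (V := R_NormedModule)), (is_RInt_minus (V := R_NormedModule)).
      + apply is_RInt_cos_mult_cos, Hz.
      + apply (is_RInt_scal (V := R_NormedModule)), Hc.
    - unfold scal, minus, plus, opp; simpl; unfold mult; simpl; field; nra. }
  apply is_RInt_ext with (fun u => plus (N u)
    (sum_n (fun k => 2 * (N u * cos ((INR k + 1) * PI * u))) n)).
  { intros u _; unfold f.
    rewrite (sum_n_ext _ (fun k => mult (2 * N u) (cos ((INR k + 1) * PI * u)))).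
    - rewrite sum_n_mult_l.
      set (c := sum_n (fun k => cos ((INR k + 1) * PI * u)) n : R).
      change (N u + 2 * N u * c = N u * (1 + 2 * c)); ring.
    - intros k; unfold mult; simpl; ring. }
  evar_last.
  - apply (is_RInt_plus (V := R_NormedModule)); [exact H0|].
    apply (is_RInt_sum_n (fun k u => 2 * (N u * cos ((INR k + 1) * PI * u)))); exact H1.
  - rewrite (sum_n_ext _ (fun k => mult (- (sin (PI * z) / (PI * z)))
       (2 * z ^ 2 / ((INR k + 1) ^ 2 - z ^ 2)))) by reflexivity.
    rewrite sum_n_mult_l.
    set (c := sum_n (fun k => 2 * z ^ 2 / ((INR k + 1) ^ 2 - z ^ 2)) n : R).
    change (sin (PI * z) / (PI * z) - cos (PI * z) + - (sin (PI * z) / (PI * z)) * c =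
      sin (PI * z) / (PI * z) * (1 - PI * z * cos (PI * z) / sin (PI * z) - c)).
    field; nra. }
set (q := fun n => 2 * z ^ 2 / ((INR n + 1) ^ 2 - z ^ 2)) in *.
set (L := 1 - PI * z * cos (PI * z) / sin (PI * z)) in *.
change (is_lim_seq (sum_n q) L).
apply is_lim_seq_ext with (fun n => L - PI * z / sin (PI * z) * RInt (f n) 0 1).
{ intros n; rewrite HI; field; nra. }
replace (Finite L) with (Finite (L - PI * z / sin (PI * z) * 0)) by (f_equal; ring).
apply is_lim_seq_minus'; [apply is_lim_seq_const|].
apply (is_lim_seq_scal_l (fun n => RInt (f n) 0 1) (PI * z / sin (PI * z)) 0 HRL).
Qed.

(** * The generating series of the even zeta values *)

Lemma dirichlet_term_INR m n : dirichlet_term (INR m) n = / (INR n + 1) ^ m.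
Proof.
unfold dirichlet_term; pose proof (pos_INR n).
rewrite Rpower_Ropp, Rpower_pow by lra; reflexivity.
Qed.

Lemma is_series_zeta m : (2 <= m)%nat ->
  is_series (fun n => / (INR n + 1) ^ m) (zeta (INR m)).
Proof.
intros Hm; apply le_INR in Hm; simpl in Hm.
unfold zeta; destruct (Rlt_dec 1 (INR m)) as [H|H]; [|lra].
apply is_series_ext with (dirichlet_term (INR m)); [intros n; apply dirichlet_term_INR|].
apply Series_correct, ex_series_dirichlet; lra.
Qed.

Lemma is_series_Rext (a b : nat -> R) (l : R) :
  (forall n, a n = b n) -> is_series a l -> is_series b l.
Proof. exact (is_series_ext (V := R_NormedModule) a b l). Qed.

Lemma is_series_Rmult_l c (a : nat -> R) (l : R) :
  is_series a l -> is_series (fun n => c * a n) (c * l).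
Proof. exact (is_series_scal_l (V := R_NormedModule) c a l). Qed.

Lemma is_series_Rminus (a b : nat -> R) (la lb : R) :
  is_series a la -> is_series b lb -> is_series (fun n => a n - b n) (la - lb).
Proof. exact (is_series_minus (V := R_NormedModule) a b la lb). Qed.

Lemma is_series_nonneg (u : nat -> R) l : (forall n, 0 <= u n) -> is_series u l -> 0 <= l.
Proof.
intros Hu Hl.
apply (is_lim_seq_le (fun _ => 0) (sum_n u) 0 l); [|apply is_lim_seq_const|exact Hl].
intros n; rewrite sum_n_Reals; apply cond_pos_sum, Hu.
Qed.

Lemma is_series_le (u v : nat -> R) l m :
  (forall n, u n <= v n) -> is_series u l -> is_series v m -> l <= m.
Proof.
intros Huv Hu Hv.
apply Rminus_le_0, (is_series_nonneg (fun n => v n - u n)).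
- intros n; apply -> Rminus_le_0; apply Huv.
- exact (is_series_Rminus v u m l Hv Hu).
Qed.

(** The summand 1 takes care of k = 0, where zeta is -1/2; for k >= 1 the Dirichlet series compare
    termwise with that of zeta(2). *)
Lemma zeta_even_bound k : Rabs (zeta (2 * INR k)) <= 1 + zeta 2.
Proof.
assert (H2 : is_series (fun n => / (INR n + 1) ^ 2) (zeta 2)) by apply (is_series_zeta 2), le_n.
assert (H2' : 0 <= zeta 2).
{ apply (is_series_nonneg _ _) with (2 := H2); intros n; pose proof (pos_INR n).
  left; apply Rinv_0_lt_compat, pow_lt; lra. }
destruct k as [|k].
- simpl INR; rewrite Rmult_0_r, zeta_0; apply Rabs_le; lra.
- replace (2 * INR (S k)) with (INR (2 * S k)) by (rewrite mult_INR; reflexivity).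
  assert (H := is_series_zeta (2 * S k) ltac:(lia)).
  apply Rabs_le; split.
  + apply Rle_trans with 0; [lra|].
    apply (is_series_nonneg _ _) with (2 := H); intros n; pose proof (pos_INR n).
    left; apply Rinv_0_lt_compat, pow_lt; lra.
  + apply Rle_trans with (zeta 2); [|lra].
    apply (is_series_le _ _ _ _) with (2 := H) (3 := H2).
    intros n; pose proof (pos_INR n).
    apply Rinv_le_contravar; [apply pow_lt; lra|apply Rle_pow; [lra|lia]].
Qed.

(** Each partial fraction is expanded as a geometric series. Instead of exchanging a double sum, one
    power of x is split off at a time, each contributing one zeta value, and what remains after K
    powers is at most x^K times the initial sum. The term zeta(0) = -1/2 removes the constant from
    (1 - pi z cot (pi z)) / 2. *)
Lemma is_series_zeta_even z : 0 < z < 1 ->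
  is_series (fun k => zeta (2 * INR k) * (z ^ 2) ^ k)
    (- (PI * z / 2) * cos (PI * z) / sin (PI * z)).
Proof.
intros Hz.
set (x := z ^ 2).
assert (Hx : 0 < x < 1) by (unfold x; nra).
(* [t K n] is the closed form of [sum_(k > K) (x / (n+1)^2) ^ k]. *)
set (t := fun K n => x / ((INR n + 1) ^ 2 - x) * (x / (INR n + 1) ^ 2) ^ K).
set (S0 := (1 - PI * z * cos (PI * z) / sin (PI * z)) / 2).
assert (HN : forall n, 1 <= (INR n + 1) ^ 2) by (intros n; pose proof (pos_INR n); nra).
assert (H0 : is_series (t 0%nat) S0).
{ apply is_series_Rext with (fun n => / 2 * (2 * z ^ 2 / ((INR n + 1) ^ 2 - z ^ 2))).
  - intros n; specialize (HN n); unfold t; fold x; rewrite pow_O; field; lra.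
  - replace S0 with (/ 2 * (1 - PI * z * cos (PI * z) / sin (PI * z)))
      by (unfold S0, Rdiv; ring).
    apply is_series_Rmult_l, is_series_cot, Hz. }
assert (HK : forall K, is_series (t (S K))
   (S0 - sum_n (fun k => zeta (2 * INR (S k)) * x ^ S k) K)).
(* Termwise, [t (S K)] is [t K] minus the leading term of its geometric series. *)
{ assert (Hstep : forall K l, is_series (t K) l ->
    is_series (t (S K)) (l - zeta (2 * INR (S K)) * x ^ S K)).
  { intros K l Hl.
    replace (2 * INR (S K)) with (INR (2 * S K)) by (rewrite mult_INR; reflexivity).
    rewrite (Rmult_comm (zeta _)).
    apply is_series_Rext with (fun n => t K n - x ^ S K * / (INR n + 1) ^ (2 * S K)).
    - intros n; specialize (HN n); unfold t.
      rewrite pow_mult; set (y := (INR n + 1) ^ 2) in *.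
      assert (y ^ K <> 0) by (apply pow_nonzero; lra).
      unfold Rdiv; rewrite !Rpow_mult_distr, !pow_inv, <- !tech_pow_Rmult.
      field; repeat split; lra.
    - apply is_series_Rminus, is_series_Rmult_l, is_series_zeta; [exact Hl|lia]. }
  intros K; induction K as [|K IH].
  - rewrite sum_O; apply Hstep, H0.
  - rewrite sum_Sn; apply Hstep in IH.
    replace (S0 - plus _ _) with
      (S0 - sum_n (fun k => zeta (2 * INR (S k)) * x ^ S k) K - zeta (2 * INR (S (S K))) * x ^ S (S K)).
    + exact IH.
    + change plus with Rplus; ring. }
assert (Ht : forall K n, 0 <= t K n <= x ^ K * t 0%nat n).
{ intros K n; specialize (HN n); unfold t.
  assert (0 <= x / ((INR n + 1) ^ 2 - x)) by (apply Rdiv_le_0_compat; lra).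
  assert (0 <= x / (INR n + 1) ^ 2) by (apply Rdiv_le_0_compat; lra).
  assert (x / (INR n + 1) ^ 2 <= x) by (apply Rle_div_l; nra).
  assert ((x / (INR n + 1) ^ 2) ^ K <= x ^ K) by (apply pow_incr; lra).
  assert (0 <= (x / (INR n + 1) ^ 2) ^ K) by (apply pow_le; lra).
  rewrite pow_O; split; nra. }
apply is_series_decr_1.
simpl INR; rewrite Rmult_0_r, zeta_0, pow_O.
replace (plus _ _) with S0.
2: { unfold S0, plus, opp; simpl; field; apply Rgt_not_eq, sin_gt_0; pose proof PI_RGT_0; nra. }
match goal with |- is_series ?u _ => change (is_lim_seq (sum_n u) S0); set (sm := sum_n u) in * end.
apply is_lim_seq_ext with (fun K => S0 - (S0 - sm K)); [intros K; ring|].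
replace (Finite S0) with (Finite (S0 - 0)) by (f_equal; ring).
apply is_lim_seq_minus'; [apply is_lim_seq_const|].
apply is_lim_seq_le_le with (fun _ => 0) (fun K => x ^ S K * S0).
- intros K; split.
  + apply (is_series_nonneg (t (S K))); [intros n; apply Ht|exact (HK K)].
  + apply (is_series_le (t (S K)) (fun n => x ^ S K * t 0%nat n)).
    * intros n; apply Ht.
    * exact (HK K).
    * apply is_series_Rmult_l, H0.
- apply is_lim_seq_const.
- replace (Finite 0) with (Rbar_mult 0 S0) by (simpl; f_equal; ring).
  apply (is_lim_seq_scal_r _ S0 0).
  apply -> (is_lim_seq_incr_1 (fun K => x ^ K)); apply is_lim_seq_geom.
  apply Rabs_def1; lra.
Qed.

(** * Moments of the weight, and termwise integration of power series *)

Lemma is_RInt_beta m j :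
  is_RInt (fun u => (1 - u) ^ m * u ^ j) 0 1
    (INR (fact m) * INR (fact j) / INR (fact (m + j + 1))).
Proof.
revert j; induction m as [|m IH]; intros j; pose proof (pos_INR j).
- evar_last.
  + apply is_RInt_ext with (fun u => u ^ j); [intros u _; simpl; ring|].
    apply (is_RInt_derive (fun u => / (INR j + 1) * u ^ S j)).
    * intros u _; auto_derive; [exact I|].
      change (match j with 0%nat => 1 | S _ => INR j + 1 end) with (INR (S j)); rewrite S_INR; simpl pred.
      field; lra.
    * intros u _; apply (ex_derive_continuous (fun u => u ^ j)); auto_derive; exact I.
  + unfold minus, plus, opp; simpl Hierarchy.AbelianMonoid.plus; simpl.
    rewrite Nat.add_1_r, fact_simpl, mult_INR, S_INR, pow1; field; split; [apply INR_fact_neq_0|lra].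
- pose proof (pos_INR m).
  (* The integrand is the derivative of (1-u)^(m+1) u^(j+1), which vanishes at both ends; this
     trades a factor 1 - u for a factor u. *)
  assert (H1 : is_RInt (fun u => (INR j + 1) * ((1 - u) ^ S m * u ^ j)
                          - (INR m + 1) * ((1 - u) ^ m * u ^ S j)) 0 1 0).
  { evar_last.
    - apply (is_RInt_derive (fun u => (1 - u) ^ S m * u ^ S j)).
      + intros u _; auto_derive; [exact I|].
        change (match j with 0%nat => 1 | S _ => INR j + 1 end) with (INR (S j)).
        change (match m with 0%nat => 1 | S _ => INR m + 1 end) with (INR (S m)).
        rewrite !S_INR; unfold Rminus; simpl; ring.
      + intros u _; apply (ex_derive_continuous (fun u => (INR j + 1) * ((1 - u) ^ S m * u ^ j)
                          - (INR m + 1) * ((1 - u) ^ m * u ^ S j))); auto_derive; repeat split.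
    - unfold minus, plus, opp; simpl; ring. }
  evar_last.
  + apply is_RInt_ext with (fun u => scal (/ (INR j + 1))
      (plus ((INR j + 1) * ((1 - u) ^ S m * u ^ j) - (INR m + 1) * ((1 - u) ^ m * u ^ S j))
            (scal (INR m + 1) ((1 - u) ^ m * u ^ S j)))).
    { intros u _; unfold scal, plus; simpl; unfold mult; simpl; field; lra. }
    apply (is_RInt_scal (V := R_NormedModule)), (is_RInt_plus (V := R_NormedModule)); [exact H1|].
    apply (is_RInt_scal (V := R_NormedModule)), IH.
  + unfold scal, plus; simpl Hierarchy.AbelianMonoid.plus; simpl; unfold mult; simpl.
    replace (m + S j + 1)%nat with (S (m + j + 1)) by lia.
    change (fact m + m * fact m)%nat with (fact (S m)).
    change (fact j + j * fact j)%nat with (fact (S j)).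
    change (fact (m + j + 1) + (m + j + 1) * fact (m + j + 1))%nat with (fact (S (m + j + 1))).
    rewrite !(fact_simpl j), !(fact_simpl m), !mult_INR, !S_INR.
    field; split; [apply INR_fact_neq_0|lra].
Qed.

(* The weight [w] of the header is [weight (2 * r - 2)]. *)
Definition weight (p : nat) (u : R) : R := (1 - u) ^ p * (2 - u) / INR (fact p).

Lemma continuous_weight p u : continuous (weight p) u.
Proof.
apply (ex_derive_continuous (weight p)); unfold weight; auto_derive; exact I.
Qed.

(** Since 2 - u = 1 + (1 - u), this is a sum of two Beta integrals. For p = 2r - 2 and j = 2k the
    numerator factor is 4r + 2k - 1 and the denominator is (2r + 2k)!. *)
Lemma is_RInt_weight p j :
  is_RInt (fun u => weight p u * u ^ j) 0 1
    (INR (fact j) * (2 * INR p + INR j + 3) / INR (fact (p + j + 2))).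
Proof.
pose proof (INR_fact_neq_0 p); pose proof (pos_INR p); pose proof (pos_INR j).
evar_last.
- apply is_RInt_ext with (fun u => scal (/ INR (fact p))
    (plus ((1 - u) ^ p * u ^ j) ((1 - u) ^ S p * u ^ j))).
  { intros u _; unfold weight, scal, plus; simpl; unfold mult; simpl; field; assumption. }
  apply (is_RInt_scal (V := R_NormedModule)), (is_RInt_plus (V := R_NormedModule)); apply is_RInt_beta.
- unfold scal, plus; simpl Hierarchy.AbelianMonoid.plus; simpl; unfold mult; simpl.
  replace (p + j + 2)%nat with (S (p + j + 1)) by lia.
  change (fact p + p * fact p)%nat with (fact (S p)).
  change (fact (p + j + 1) + (p + j + 1) * fact (p + j + 1))%nat with (fact (S (p + j + 1))).
  rewrite !fact_simpl, !mult_INR, !S_INR, !plus_INR; simpl INR.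
  field; repeat split; try apply INR_fact_neq_0; lra.
Qed.

(** A radius above 1 makes the coefficients absolutely summable, so the tail of their absolute
    values bounds the truncation error uniformly on [0, 1]. Integration against [W] costs only a
    bound of [W]. *)
Lemma is_series_RInt_PSeries (b : nat -> R) (W : R -> R) :
  Rbar_lt 1 (CV_radius b) -> (forall u, 0 <= u <= 1 -> continuous W u) ->
  is_series (fun k => b k * RInt (fun u => W u * u ^ (2 * k)) 0 1)
    (RInt (fun u => W u * PSeries b (u ^ 2)) 0 1).
Proof.
intros Hb HW.
assert (Hab : ex_series (fun k => Rabs (b k))).
{ apply ex_series_ext with (fun k => Rabs (b k * 1 ^ k)).
  - intros k; rewrite pow1, Rmult_1_r; reflexivity.
  - apply CV_disk_inside; rewrite Rabs_R1; exact Hb. }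
assert (Hcw : forall g, (forall u, 0 <= u <= 1 -> continuous g u) ->
  ex_RInt (fun u => W u * g u) 0 1).
{ intros g Hg; apply (ex_RInt_continuous (fun u => W u * g u)); intros u.
  rewrite Rmin_left, Rmax_right by lra; intros Hu.
  apply (continuous_mult W g); [apply HW|apply Hg]; exact Hu. }
assert (Hpow : forall k u, continuous (fun u => u ^ k) u).
{ intros k u; apply (ex_derive_continuous (fun u => u ^ k)); auto_derive; exact I. }
assert (HP : ex_RInt (fun u => W u * PSeries b (u ^ 2)) 0 1).
{ apply Hcw; intros u Hu.
  apply (continuous_comp (fun u => u ^ 2) (PSeries b)); [apply Hpow|].
  apply continuity_pt_filterlim, PSeries_continuity.
  apply Rbar_le_lt_trans with (2 := Hb); simpl; apply Rabs_le; nra. }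
destruct (bounded_continuity W 0 1) as [C HC]; [exact HW|].
set (J := RInt (fun u => W u * PSeries b (u ^ 2)) 0 1) in *.
set (tail := fun K => Series (fun k => Rabs (b k)) - sum_n (fun k => Rabs (b k)) K).
assert (Htail : is_lim_seq tail 0).
{ unfold tail.
  replace (Finite 0) with (Finite (Series (fun k => Rabs (b k)) - Series (fun k => Rabs (b k))))
    by (f_equal; ring).
  apply is_lim_seq_minus'; [apply is_lim_seq_const|].
  exact (Series_correct _ Hab). }
assert (HT : forall x K, 0 <= x <= 1 ->
  Rabs (PSeries b x - sum_n (fun k => b k * x ^ k) K) <= tail K).
{ intros x K Hx.
  assert (Hbx : forall k, Rabs (b k * x ^ k) <= Rabs (b k)).
  { intros k; rewrite Rabs_mult, (Rabs_pos_eq (x ^ k)) by (apply pow_le; lra).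
    assert (x ^ k <= 1) by (rewrite <- (pow1 k); apply pow_incr; lra).
    pose proof (Rabs_pos (b k)); nra. }
  assert (Hexa : ex_series (fun k => Rabs (b k * x ^ k))).
  { apply (ex_series_le (V := R_CompleteNormedModule)) with (2 := Hab); intros k.
    unfold norm; simpl; unfold abs; simpl; rewrite Rabs_Rabsolu; apply Hbx. }
  unfold tail, PSeries.
  rewrite (Series_incr_n (fun k => b k * x ^ k) (S K)), (Series_incr_n (fun k => Rabs (b k)) (S K))
    by (try lia; try exact Hab; apply ex_series_Rabs, Hexa).
  simpl pred; rewrite !sum_n_Reals.
  match goal with |- Rabs (?a + ?c - ?a) <= ?a' + ?c' - ?a' =>
    replace (a + c - a) with c by ring; replace (a' + c' - a') with c' by ring end.
  eapply Rle_trans; [apply Series_Rabs|].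
  - apply (ex_series_incr_n (fun k => Rabs (b k * x ^ k)) (S K)), Hexa.
  - apply Series_le; [intros n; split; [apply Rabs_pos|apply Hbx]|].
    apply (ex_series_incr_n (fun k => Rabs (b k)) (S K)), Hab. }
assert (Hpart : forall K, is_RInt (fun u => W u * sum_n (fun k => b k * (u ^ 2) ^ k) K) 0 1
  (sum_n (fun k => b k * RInt (fun u => W u * u ^ (2 * k)) 0 1) K)).
{ intros K.
  apply is_RInt_ext with (fun u => sum_n (fun k => b k * (W u * u ^ (2 * k))) K).
  { intros u _.
    rewrite (sum_n_ext _ (fun k => mult (W u) (b k * (u ^ 2) ^ k))).
    - rewrite sum_n_mult_l; reflexivity.
    - intros k; rewrite pow_mult; unfold mult; simpl; ring. }
  apply (is_RInt_sum_n (fun k u => b k * (W u * u ^ (2 * k)))).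
  intros k; apply (is_RInt_scal (V := R_NormedModule)).
  apply (RInt_correct (fun u => W u * u ^ (2 * k))), Hcw; intros; apply Hpow. }
set (sm := sum_n (fun k => b k * RInt (fun u => W u * u ^ (2 * k)) 0 1)) in *.
change (is_lim_seq sm J).
apply is_lim_seq_ext with (fun K => J - (J - sm K)); [intros K; ring|].
replace (Finite J) with (Finite (J - 0)) by (f_equal; ring).
apply is_lim_seq_minus'; [apply is_lim_seq_const|].
apply is_lim_seq_abs_0, is_lim_seq_le_le with (fun _ => 0) (fun K => C * tail K).
- intros K; split; [apply Rabs_pos|].
  assert (Hd : is_RInt (fun u => W u * PSeries b (u ^ 2) - W u * sum_n (fun k => b k * (u ^ 2) ^ k) K)
     0 1 (J - sm K)).
  { apply (is_RInt_minus (V := R_NormedModule)); [exact (RInt_correct _ _ _ HP)|apply Hpart]. }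
  rewrite <- (is_RInt_unique _ _ _ _ Hd).
  replace (C * tail K) with ((1 - 0) * (C * tail K)) by ring.
  apply abs_RInt_le_const; [lra|eexists; exact Hd|].
  intros u Hu; rewrite <- Rmult_minus_distr_l, Rabs_mult.
  specialize (HC u Hu); unfold norm in HC; simpl in HC; unfold abs in HC; simpl in HC.
  apply Rmult_le_compat; try apply Rabs_pos; [lra|].
  apply HT; nra.
- apply is_lim_seq_const.
- replace (Finite 0) with (Rbar_mult C 0) by (simpl; f_equal; ring).
  apply (is_lim_seq_scal_l tail C 0 Htail).
Qed.

(** * Sine moments of powers *)

Definition cos_taylor (q : nat) (a : R) : R :=
  sum_n (fun k => (-1) ^ k * (a ^ (2 * k) / INR (fact (2 * k)))) q.

Definition sin_moment (q : nat) (a : R) : R :=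
  (-1) ^ q / a ^ (2 * q + 1) * (cos_taylor q a - cos a).

Lemma cos_taylor_S q a :
  cos_taylor (S q) a = cos_taylor q a + (-1) ^ S q * (a ^ (2 * S q) / INR (fact (2 * S q))).
Proof. unfold cos_taylor; rewrite sum_Sn; reflexivity. Qed.

(** The recursion produced by two integrations by parts of the sine moment; in the closed form it
    amounts to splitting off the Taylor term of degree 2q + 2. *)
Lemma sin_moment_S q a : a <> 0 ->
  sin_moment (S q) a = / (a * INR (fact (2 * S q))) - sin_moment q a / a ^ 2.
Proof.
intros Ha; unfold sin_moment; rewrite cos_taylor_S.
assert (Hq : (-1) ^ q * (-1) ^ q = 1).
{ rewrite <- Rpow_mult_distr; replace (-1 * -1) with 1 by ring; apply pow1. }
replace (2 * S q + 1)%nat with (2 * q + 1 + 2)%nat by lia.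
replace (a ^ (2 * S q)) with (a ^ (2 * q + 1) * a) 
  by (replace (2 * S q)%nat with (S (2 * q + 1)) by lia; simpl; ring).
rewrite pow_add, <- tech_pow_Rmult.
assert (a ^ (2 * q + 1) <> 0) by (apply pow_nonzero; exact Ha).
pose proof (INR_fact_neq_0 (2 * S q)).
set (A := a ^ (2 * q + 1)) in *; set (s := (-1) ^ q) in *; set (F := INR (fact (2 * S q))) in *.
transitivity (s * s / (a * F) - s * (cos_taylor q a - cos a) / (A * a ^ 2)).
- field; auto.
- rewrite Hq; field; auto.
Qed.

Lemma is_RInt_sin_moment q a : a <> 0 ->
  is_RInt (fun u => (1 - u) ^ (2 * q) / INR (fact (2 * q)) * sin (a * u)) 0 1 (sin_moment q a).
Proof.
intros Ha; induction q as [|q IH].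
- evar_last.
  + apply is_RInt_ext with (fun u => sin (a * u)); [intros u _; simpl; field|].
    apply (is_RInt_derive (fun u => - cos (a * u) / a)).
    * intros u _; auto_derive; [exact I|field; exact Ha].
    * intros u _; apply (ex_derive_continuous (fun u => sin (a * u))); auto_derive; exact I.
  + unfold minus, plus, opp, sin_moment, cos_taylor; rewrite sum_O; simpl.
    rewrite Rmult_0_r, cos_0, Rmult_1_r; field; exact Ha.
- set (n := (2 * q)%nat) in *.
  replace (2 * S q)%nat with (S (S n)) by (unfold n; lia).
  pose proof (INR_fact_neq_0 n); pose proof (pos_INR n).
  (* The boundary terms of two integrations by parts. [F 1] vanishes, and at 0 only the cosine part
     survives. *)
  set (F := fun u => - ((1 - u) ^ S (S n) / INR (fact (S (S n))) * cos (a * u)) / a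
                 - (1 - u) ^ S n / INR (fact (S n)) * sin (a * u) / a ^ 2).
  assert (H1 : is_RInt (fun u => (1 - u) ^ S (S n) / INR (fact (S (S n))) * sin (a * u)
     + / a ^ 2 * ((1 - u) ^ n / INR (fact n) * sin (a * u))) 0 1 (minus (F 1) (F 0))).
  { apply (is_RInt_derive F).
    - intros u _; unfold F; rewrite !fact_simpl, !mult_INR; auto_derive; [exact I|].
      change (match n with 0%nat => 1 | S _ => INR n + 1 end) with (INR (S n)).
      rewrite !S_INR; simpl pred; unfold Rminus; simpl pow.
      field; lra.
    - intros u _; apply (ex_derive_continuous (fun u => (1 - u) ^ S (S n) / INR (fact (S (S n))) * sin (a * u)
     + / a ^ 2 * ((1 - u) ^ n / INR (fact n) * sin (a * u)))); auto_derive; repeat split. }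
  evar_last.
  + apply is_RInt_Rext with (fun u => ((1 - u) ^ S (S n) / INR (fact (S (S n))) * sin (a * u)
     + / a ^ 2 * ((1 - u) ^ n / INR (fact n) * sin (a * u)))
       - / a ^ 2 * ((1 - u) ^ n / INR (fact n) * sin (a * u))); [intros u; ring|].
    apply is_RInt_Rminus; [exact H1|].
    apply is_RInt_Rmult_l, IH.
  + rewrite sin_moment_S by exact Ha.
    replace (2 * S q)%nat with (S (S n)) by (unfold n; lia).
    pose proof (INR_fact_neq_0 (S (S n))).
    change (minus (F 1) (F 0)) with (F 1 - F 0); unfold F.
    replace (1 - 1) with 0 by ring; rewrite Rminus_0_r, !pow1, Rmult_0_r, cos_0, sin_0.
    rewrite (pow_i (S (S n))), (pow_i (S n)) by lia.
    field; repeat split; try assumption; apply INR_fact_neq_0.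
Qed.

(** The coefficient of a^(2k) in the first summand is -(-1)^k / (2k-2)!, that is -(-1)^k 2k (2k-1) /
    (2k)!. [A] stays arbitrary because the induction on [q] needs it fixed; the value cancelling the
    top term depends on [q]. *)
Lemma cos_taylor_combination (A a : R) q :
  a ^ 2 * cos_taylor q a + A * cos_taylor (S q) a =
  A + sum_n_m (fun k => (-1) ^ k * (A - 2 * INR k * (2 * INR k - 1)) / INR (fact (2 * k))
                        * a ^ (2 * k)) 1 (S q).
Proof.
induction q as [|q IH].
- rewrite sum_n_n, cos_taylor_S; unfold cos_taylor; rewrite sum_O; simpl; field.
- rewrite (sum_n_Sm _ 1 (S q)) by lia; change plus with Rplus.
  rewrite <- Rplus_assoc, <- IH, (cos_taylor_S (S q)), (cos_taylor_S q a).
  set (c := cos_taylor q a).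
  replace (2 * S (S q))%nat with (S (S (2 * S q))) by lia.
  rewrite !fact_simpl, !mult_INR.
  pose proof (INR_fact_neq_0 (2 * S q)); set (F := INR (fact (2 * S q))) in *.
  rewrite !S_INR, mult_INR, !S_INR, <- !tech_pow_Rmult; simpl (INR 0).
  pose proof (pos_INR q).
  set (y := a ^ (2 * S q)); set (s := (-1) ^ q).
  field; repeat split; try lra.
Qed.

(** * Summation over the multiples of pi / 2 *)

Lemma is_series_of_subseq (u : nat -> R) (phi : nat -> nat) (l : R) :
  ex_series u -> (forall n, (phi n < phi (S n))%nat) ->
  is_lim_seq (fun n => sum_n u (phi n)) l -> is_series u l.
Proof.
intros [m Hm] Hphi Hl.
assert (H : is_lim_seq (fun n => sum_n u (phi n)) m).
{ apply (is_lim_seq_subseq (sum_n u) m phi); [|exact Hm].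
  apply eventually_subseq, Hphi. }
apply is_lim_seq_unique in H; apply is_lim_seq_unique in Hl.
rewrite H in Hl; injection Hl as <-; exact Hm.
Qed.

(* Only even [INR n + 1] contribute, and they give [- / 2 ^ m] times the
   alternating zeta series. *)
Lemma is_series_cos_quarter m : (2 <= m)%nat ->
  is_series (fun n => cos ((INR n + 1) * (PI / 2)) / (INR n + 1) ^ m)
    (- (/ 2 ^ m * (1 - 2 / 2 ^ m) * zeta (INR m))).
Proof.
intros Hm.
assert (Hm1 : 1 < INR m) by (apply le_INR in Hm; simpl in Hm; lra).
assert (Halt : is_series (fun k => (-1) ^ k * dirichlet_term (INR m) k) ((1 - 2 / 2 ^ m) * zeta (INR m))).
{ replace (2 / 2 ^ m) with (Rpower 2 (1 - INR m)).
  - unfold zeta; destruct (Rlt_dec 1 (INR m)) as [H|H]; [|lra].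
    rewrite <- Series_dirichlet_alternating by lra; apply Series_correct, ex_series_Rabs.
    apply ex_series_ext with (dirichlet_term (INR m)); [|apply ex_series_dirichlet; lra].
    intros k; rewrite Rabs_mult, pow_1_abs, Rmult_1_l.
    symmetry; apply Rabs_pos_eq; left; apply dirichlet_term_gt0.
  - rewrite <- Rpower2_mul, Rpower_Ropp, Rpower_pow by lra; reflexivity. }
assert (Hcos : forall k, cos ((INR (2 * k) + 1) * (PI / 2)) = 0 /\
   cos ((INR (2 * k + 1) + 1) * (PI / 2)) = - (-1) ^ k).
{ intros k; induction k as [|k [IH1 IH2]].
  - simpl INR; split.
    + replace ((0 + 1) * (PI / 2)) with (PI / 2) by ring; apply cos_PI2.
    + replace ((1 + 1) * (PI / 2)) with PI by field; rewrite cos_PI; simpl; ring.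
  - replace (2 * S k)%nat with (S (S (2 * k))) by lia.
    replace (S (S (2 * k)) + 1)%nat with (S (S (2 * k + 1))) by lia.
    rewrite !S_INR.
    replace ((INR (2 * k) + 1 + 1 + 1) * (PI / 2)) with ((INR (2 * k) + 1) * (PI / 2) + PI) by field.
    replace ((INR (2 * k + 1) + 1 + 1 + 1) * (PI / 2)) with ((INR (2 * k + 1) + 1) * (PI / 2) + PI) by field.
    rewrite !neg_cos, IH1, IH2; simpl; split; ring. }
(* Terms are taken in pairs: index 2n has a zero cosine, and index 2n + 1 carries the n-th term of
   the alternating series. *)
apply is_series_of_subseq with (fun n => (2 * n + 1)%nat).
- apply (ex_series_le (V := R_CompleteNormedModule)) with (dirichlet_term (INR m)).
  + intros n; rewrite dirichlet_term_INR; unfold norm; simpl; unfold abs; simpl.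
    assert (0 < / (INR n + 1) ^ m)
      by (apply Rinv_0_lt_compat, pow_lt; pose proof (pos_INR n); lra).
    unfold Rdiv; rewrite Rabs_mult, (Rabs_pos_eq (/ _)) by lra.
    assert (Rabs (cos ((INR n + 1) * (PI / 2))) <= 1) by apply Rabs_le, COS_bound.
    nra.
  + apply ex_series_dirichlet; lra.
- intros n; lia.
- apply is_lim_seq_ext with
    (fun n => - / 2 ^ m * sum_n (fun k => (-1) ^ k * dirichlet_term (INR m) k) n).
  + assert (Hstep : forall n, cos ((INR (2 * n) + 1) * (PI / 2)) / (INR (2 * n) + 1) ^ m = 0 /\
      cos ((INR (2 * n + 1) + 1) * (PI / 2)) / (INR (2 * n + 1) + 1) ^ m =
        - / 2 ^ m * ((-1) ^ n * dirichlet_term (INR m) n)).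
    { intros n; destruct (Hcos n) as [-> ->]; split; [unfold Rdiv; ring|].
      rewrite dirichlet_term_INR.
      replace (INR (2 * n + 1) + 1) with (2 * (INR n + 1)) by (rewrite plus_INR, mult_INR; simpl; ring).
      pose proof (pos_INR n).
      rewrite Rpow_mult_distr; field; split; apply pow_nonzero; lra. }
    intros n; induction n as [|n IH].
    * replace (2 * 0 + 1)%nat with 1%nat by reflexivity; rewrite (sum_Sn _ 0), !sum_O; change plus with Rplus.
      destruct (Hstep 0%nat) as [H1 H2]; simpl Nat.mul in H1, H2; simpl Nat.add in H1, H2.
      rewrite H1, H2; ring.
    * replace (2 * S n + 1)%nat with (S (S (2 * n + 1))) by lia.
      rewrite !sum_Sn, <- IH; change plus with Rplus.
      destruct (Hstep (S n)) as [H1 H2].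
      replace (S (2 * n + 1)) with (2 * S n)%nat by lia.
      replace (S (2 * S n)) with (2 * S n + 1)%nat by lia.
      rewrite H1, H2; ring.
  + replace (- (/ 2 ^ m * (1 - 2 / 2 ^ m) * zeta (INR m)))
      with (- / 2 ^ m * ((1 - 2 / 2 ^ m) * zeta (INR m))) by ring.
    apply (is_lim_seq_scal_l _ (- / 2 ^ m) ((1 - 2 / 2 ^ m) * zeta (INR m))).
    exact Halt.
Qed.

Lemma is_series_sum_n_m (F : nat -> nat -> R) (l : nat -> R) a b :
  (forall k, (a <= k <= b)%nat -> is_series (F k) (l k)) ->
  is_series (fun n => sum_n_m (fun k => F k n) a b) (sum_n_m l a b).
Proof.
destruct (Nat.le_gt_cases a b) as [Hab|Hab].
- induction Hab as [|b Hab IH]; intros H.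
  + rewrite sum_n_n; apply is_series_Rext with (F a).
    * intros n; rewrite sum_n_n; reflexivity.
    * apply H; lia.
  + rewrite sum_n_Sm by lia.
    apply is_series_Rext with (fun n => plus (sum_n_m (fun k => F k n) a b) (F (S b) n)).
    * intros n; rewrite sum_n_Sm by lia; reflexivity.
    * apply (is_series_plus (V := R_NormedModule)).
      -- apply IH; intros k Hk; apply H; lia.
      -- apply H; lia.
- intros _; rewrite sum_n_m_zero by lia.
  apply is_series_Rext with (fun _ => 0 * / (INR 0 + 1)).
  + intros n; rewrite sum_n_m_zero by lia; unfold zero; simpl; ring.
  + change (is_lim_seq (sum_n (fun _ => 0 * / (INR 0 + 1))) 0).
    apply is_lim_seq_ext with (fun _ => 0); [|apply is_lim_seq_const].
    intros n; rewrite sum_n_const; ring.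
Qed.

(** * The series as an integral *)

Lemma sum_n_m_Rmult_l (c : R) (u : nat -> R) a b :
  sum_n_m (fun k => c * u k) a b = c * sum_n_m u a b.
Proof. exact (sum_n_m_mult_l (K := R_Ring) c u a b). Qed.

(** This [A] is the one for which the coefficient of a^(2q+2) is zero, so the sum stops at [q] and
    no 1/a remains after division by a^(2q+3). *)
Lemma sin_moment_combination q a (A := 2 * INR (S q) * (2 * INR (S q) - 1)) : a <> 0 ->
  sin_moment q a - A * sin_moment (S q) a =
  (-1) ^ q / a ^ (2 * q + 3) *
    (A + sum_n_m (fun k => (-1) ^ k * (A - 2 * INR k * (2 * INR k - 1)) / INR (fact (2 * k))
                           * a ^ (2 * k)) 1 q
     - a ^ 2 * cos a - A * cos a).
Proof.
intros Ha.
pose proof (cos_taylor_combination A a q) as H.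
rewrite sum_n_Sm in H by lia.
assert (HA : A - 2 * INR (S q) * (2 * INR (S q) - 1) = 0) by (unfold A; ring).
rewrite HA in H.
unfold plus in H; cbn -[sum_n_m pow INR fact Nat.mul] in H.
set (s := sum_n_m _ 1 q) in *.
unfold sin_moment.
replace (2 * S q + 1)%nat with (2 * q + 3)%nat by lia.
replace (2 * q + 3)%nat with (2 * q + 1 + 2)%nat by lia.
rewrite (pow_add a (2 * q + 1) 2).
assert (a ^ (2 * q + 1) <> 0) by (apply pow_nonzero; exact Ha).
replace (A + s) with (a ^ 2 * cos_taylor q a + A * cos_taylor (S q) a)
  by (rewrite H; unfold Rdiv; ring).
rewrite <- (tech_pow_Rmult (-1) q); field; auto.
Qed.

(** After the cancellation the pure powers of 1/(n+1) have exponents at least 3 and sum to zeta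
    values. The cosine terms have exponents 2q + 1 and 2q + 3, and [1 <= q] keeps the smaller one
    above 1. *)
Lemma is_series_sin_moment_combination q
    (A := 2 * INR (S q) * (2 * INR (S q) - 1)) (h := PI / 2) : (1 <= q)%nat ->
  is_series (fun n => sin_moment q ((INR n + 1) * h) - A * sin_moment (S q) ((INR n + 1) * h))
    ((-1) ^ q / h ^ (2 * q + 3) *
      (A * zeta (INR (2 * q + 3))
       + sum_n_m (fun k => (-1) ^ k * (A - 2 * INR k * (2 * INR k - 1)) / INR (fact (2 * k))
                   * h ^ (2 * k) * zeta (INR (2 * q + 3 - 2 * k))) 1 q
       - h ^ 2 * - (/ 2 ^ (2 * q + 1) * (1 - 2 / 2 ^ (2 * q + 1)) * zeta (INR (2 * q + 1)))
       - A * - (/ 2 ^ (2 * q + 3) * (1 - 2 / 2 ^ (2 * q + 3)) * zeta (INR (2 * q + 3))))).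
Proof.
intros Hq.
assert (Hh : h <> 0) by (unfold h; pose proof PI_RGT_0; lra).
set (C := fun k => (-1) ^ k * (A - 2 * INR k * (2 * INR k - 1)) / INR (fact (2 * k)) * h ^ (2 * k)).
apply is_series_Rext with (fun n => (-1) ^ q / h ^ (2 * q + 3) *
  (A * / (INR n + 1) ^ (2 * q + 3)
   + sum_n_m (fun k => C k * / (INR n + 1) ^ (2 * q + 3 - 2 * k)) 1 q
   - h ^ 2 * (cos ((INR n + 1) * (PI / 2)) / (INR n + 1) ^ (2 * q + 1))
   - A * (cos ((INR n + 1) * (PI / 2)) / (INR n + 1) ^ (2 * q + 3)))).
- intros n; pose proof (pos_INR n); fold h.
  rewrite sin_moment_combination by nra; fold A.
  set (N := INR n + 1) in *.
  assert (HN : forall j, N ^ j <> 0) by (intros j; apply pow_nonzero; unfold N; lra).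
  assert (Hhp : forall j, h ^ j <> 0) by (intros j; apply pow_nonzero, Hh).
  rewrite (sum_n_m_ext_loc (fun k => C k * / N ^ (2 * q + 3 - 2 * k))
    (fun k => / N ^ (2 * q + 3) * ((-1) ^ k * (A - 2 * INR k * (2 * INR k - 1)) / INR (fact (2 * k))
                   * (N * h) ^ (2 * k)))).
  + rewrite sum_n_m_Rmult_l, Rpow_mult_distr, (Rpow_mult_distr N h 2).
    replace (N ^ (2 * q + 3)) with (N ^ (2 * q + 1) * N ^ 2) by (rewrite <- pow_add; f_equal; lia).
    specialize (Hhp (2 * q + 3)%nat); pose proof (HN (2 * q + 1)%nat); pose proof (HN 1%nat).
    field; repeat split; auto; rewrite pow_1 in *; auto.
  + intros k Hk; unfold C.
    replace (N ^ (2 * q + 3)) with (N ^ (2 * q + 3 - 2 * k) * N ^ (2 * k)) by (rewrite <- pow_add; f_equal; lia).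
    rewrite Rpow_mult_distr.
    pose proof (INR_fact_neq_0 (2 * k)).
    match goal with |- ?x = ?y => change (@eq R x y) end.
    field; repeat split; auto.
- apply is_series_Rmult_l.
  apply is_series_Rminus; [apply is_series_Rminus|].
  + apply (is_series_plus (V := R_NormedModule)).
    * apply is_series_Rmult_l, is_series_zeta; lia.
    * apply (is_series_sum_n_m (fun k n => C k * / (INR n + 1) ^ (2 * q + 3 - 2 * k))
        (fun k => C k * zeta (INR (2 * q + 3 - 2 * k)))).
      intros k Hk; apply is_series_Rmult_l, is_series_zeta; lia.
  + apply is_series_Rmult_l, is_series_cos_quarter; lia.
  + apply is_series_Rmult_l, is_series_cos_quarter; lia.
Qed.

(** Coefficients of Z(u/4) as a power series in u^2, which leaves out the zero odd coefficients. *)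
Definition zeta_even_coef (k : nat) : R := zeta (2 * INR k) / 4 ^ (2 * k).

Lemma CV_radius_zeta_even_coef : Rbar_lt 1 (CV_radius zeta_even_coef).
Proof.
(* Bounded zeta values make the coefficients O(16^(-k)), so at 2 the terms are still O(8^(-k)). *)
apply Rbar_lt_le_trans with 2; [simpl; lra|].
apply (CV_radius_bounded zeta_even_coef); exists (1 + zeta 2); intros n.
unfold zeta_even_coef.
replace (zeta (2 * INR n) / 4 ^ (2 * n) * 2 ^ n) with (zeta (2 * INR n) * (/ 8) ^ n).
- rewrite Rabs_mult, (Rabs_pos_eq ((/ 8) ^ n)) by (apply pow_le; lra).
  assert ((/ 8) ^ n <= 1) by (rewrite <- (pow1 n); apply pow_incr; lra).
  assert (0 <= (/ 8) ^ n) by (apply pow_le; lra).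
  pose proof (zeta_even_bound n); pose proof (Rabs_pos (zeta (2 * INR n))); nra.
- rewrite pow_mult; unfold Rdiv; rewrite <- pow_inv, Rmult_assoc, <- Rpow_mult_distr.
  do 2 f_equal; field.
Qed.

Lemma PSeries_zeta_even_coef u : 0 < u < 1 ->
  PSeries zeta_even_coef (u ^ 2) =
  - (PI * u / 8) * cos (PI / 4 * u) / sin (PI / 4 * u).
Proof.
intros Hu; unfold PSeries; apply is_series_unique.
replace (- (PI * u / 8) * cos (PI / 4 * u) / sin (PI / 4 * u)) with
  (- (PI * (u / 4) / 2) * cos (PI * (u / 4)) / sin (PI * (u / 4))).
- apply is_series_Rext with (fun k => zeta (2 * INR k) * ((u / 4) ^ 2) ^ k).
  + intros k; unfold zeta_even_coef, Rdiv.
    rewrite (pow_mult 4), <- pow_inv, Rmult_assoc, <- Rpow_mult_distr; do 2 f_equal; field.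
  + apply is_series_zeta_even; lra.
- replace (PI * (u / 4)) with (PI / 4 * u) by field; unfold Rdiv; field.
  apply Rgt_not_eq, sin_gt_0; pose proof PI_RGT_0; nra.
Qed.

(** With x = pi u / 4, the kernel identity cancels the cotangent in [g] against the partial sums of
    [s]. What is left is -(pi/8) u w(u) cos ((2n+3) x) / sin x, whose factor u offsets the zero of
    the sine, so its integral tends to 0. *)
Lemma RInt_weight_zeta_even q (A := 2 * INR (S q) * (2 * INR (S q) - 1)) :
  is_series (fun n => PI / 4 * (sin_moment q ((INR n + 1) * (PI / 2))
                                - A * sin_moment (S q) ((INR n + 1) * (PI / 2))))
    (- RInt (fun u => weight (2 * q) u * PSeries zeta_even_coef (u ^ 2)) 0 1).
Proof.
pose proof PI_RGT_0.
set (p := (2 * q)%nat).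
set (g := fun u => weight p u * PSeries zeta_even_coef (u ^ 2)).
set (J := RInt g 0 1).
assert (Hgc : forall u, 0 <= u <= 1 -> continuous g u).
{ intros u Hu; apply (continuous_mult (weight p)); [apply continuous_weight|].
  apply (continuous_comp (fun u => u ^ 2) (PSeries zeta_even_coef)).
  - apply (ex_derive_continuous (fun u => u ^ 2)); auto_derive; exact I.
  - apply continuity_pt_filterlim, PSeries_continuity.
    apply Rbar_le_lt_trans with (2 := CV_radius_zeta_even_coef); simpl; apply Rabs_le; nra. }
assert (HJ : is_RInt g 0 1 J).
{ apply (RInt_correct g), (ex_RInt_continuous g); intros u.
  rewrite Rmin_left, Rmax_right by lra; apply Hgc. }
set (s := fun n u => PI / 4 * (weight p u * u * sin ((INR n + 1) * (PI / 2) * u))).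
set (S1 := fun n => PI / 4 * (sin_moment q ((INR n + 1) * (PI / 2))
                                - A * sin_moment (S q) ((INR n + 1) * (PI / 2)))).
assert (Hs : forall n, is_RInt (s n) 0 1 (S1 n)).
{ intros n; pose proof (pos_INR n); apply is_RInt_Rmult_l.
  (* [A] equals (2q+2)! / (2q)!, the change of normalisation between the two sine moments. *)
  apply is_RInt_Rext with (fun u =>
     (1 - u) ^ (2 * q) / INR (fact (2 * q)) * sin ((INR n + 1) * (PI / 2) * u)
     - A * ((1 - u) ^ (2 * S q) / INR (fact (2 * S q)) * sin ((INR n + 1) * (PI / 2) * u))).
  - intros u; unfold weight, A.
    replace (2 * S q)%nat with (S (S (2 * q))) by lia; fold p.
    pose proof (INR_fact_neq_0 p); pose proof (pos_INR q).
    assert (Hp : INR p = 2 * INR q) by (unfold p; rewrite mult_INR; reflexivity).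
    rewrite !fact_simpl, !mult_INR, !S_INR, Hp, <- !tech_pow_Rmult.
    field; repeat split; lra.
  - apply is_RInt_Rminus; [|apply is_RInt_Rmult_l]; apply is_RInt_sin_moment; nra. }
assert (Hsc : forall n u, continuous (s n) u).
{ intros n u; apply (ex_derive_continuous (s n)); unfold s, weight; auto_derive; exact I. }
set (f := fun n u => g u + sum_n (fun k => s k u) n).
assert (Hf : forall n, is_RInt (f n) 0 1 (J + sum_n S1 n)).
{ intros n; apply is_RInt_Rplus; [exact HJ|]; apply (is_RInt_sum_n s S1), Hs. }
assert (HRL : is_lim_seq (fun n => RInt (f n) 0 1) 0).
{ assert (Hw : forall u, 0 <= u <= 1 -> Rabs (weight p u) <= 2 / INR (fact p)).
  { intros u Hu; unfold weight, Rdiv; pose proof (INR_fact_lt_0 p).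
    assert (0 < / INR (fact p)) by (apply Rinv_0_lt_compat; lra).
    assert (0 <= (1 - u) ^ p) by (apply pow_le; lra).
    assert ((1 - u) ^ p <= 1) by (apply Rle_trans with (1 ^ p); [apply pow_incr|rewrite pow1]; lra).
    rewrite Rabs_pos_eq by (repeat apply Rmult_le_pos; lra).
    apply Rmult_le_compat_r; nra. }
  (* The phase [PI / 2] turns the sine of [riemann_lebesgue] into the cosine of the remainder; the
     frequency is (2n+3) pi / 4. *)
  apply (riemann_lebesgue (PI / 4) (PI / 2) (PI / 8 * (2 / INR (fact p)))
           (fun u => - (PI / 8) * (u * weight p u))
           (Derive (fun u => - (PI / 8) * (u * weight p u)))
           (fun n => PI / 2 * INR n + 3 * PI / 4)).
  - lra.
  - intros u; apply Derive_correct; unfold weight; auto_derive; exact I.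
  - intros u.
    assert (Hd : forall v, is_derive (fun u => - (PI / 8) * (u * weight p u)) v
       (- (PI / 8) * (weight p v + v * (- (INR p * (1 - v) ^ pred p) * (2 - v) - (1 - v) ^ p) / INR (fact p)))).
    { intros v; unfold weight; auto_derive; [exact I|]; unfold Rdiv, Rminus; ring. }
    apply continuous_ext with (2 := ex_derive_continuous (fun v => 
       (- (PI / 8) * (weight p v + v * (- (INR p * (1 - v) ^ pred p) * (2 - v) - (1 - v) ^ p) / INR (fact p)))) u
       ltac:(unfold weight; auto_derive; repeat split)).
    intros v; symmetry; apply is_derive_unique, Hd.
  - intros u Hu; rewrite !Rabs_mult, Rabs_Ropp, (Rabs_pos_eq (PI / 8)), (Rabs_pos_eq u) by lra.
    pose proof (Hw u Hu).
    replace (PI / 8 * (2 / INR (fact p)) * u) with (PI / 8 * (u * (2 / INR (fact p)))) by ring.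
    apply Rmult_le_compat_l; [lra|]; apply Rmult_le_compat_l; lra.
  - apply is_lim_seq_affine; lra.
  - intros n u Hu; apply (continuous_plus g (fun u => sum_n (fun k => s k u) n)); [apply Hgc, Hu|].
    induction n as [|n IH].
    + apply continuous_ext with (s 0%nat); [intros v; rewrite sum_O; reflexivity|apply Hsc].
    + apply continuous_ext with (fun v => plus (sum_n (fun k => s k v) n) (s (S n) v)).
      * intros v; rewrite sum_Sn; reflexivity.
      * apply (continuous_plus (fun v => sum_n (fun k => s k v) n) (s (S n))); [exact IH|apply Hsc].
  - intros n u Hu; unfold f, g; rewrite PSeries_zeta_even_coef by exact Hu.
    assert (Hsu : 0 < sin (PI / 4 * u)) by (apply sin_gt_0; nra).
    rewrite (Rplus_comm _ (PI / 2)), <- cos_sin.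
    pose proof (dirichlet_kernel_sin (PI / 4 * u) n) as HD.
    replace ((2 * INR n + 3) * (PI / 4 * u)) with ((PI / 2 * INR n + 3 * PI / 4) * u) in HD by field.
    set (c1 := cos ((PI / 2 * INR n + 3 * PI / 4) * u)) in *.
    rewrite (sum_n_ext _ (fun k => mult (PI / 4 * (weight p u * u))
                                     (sin (2 * (INR k + 1) * (PI / 4 * u))))).
    + rewrite sum_n_mult_l.
      set (c2 := sum_n (fun k => sin (2 * (INR k + 1) * (PI / 4 * u))) n : R) in *.
      change (2 * sin (PI / 4 * u) * c2 = cos (PI / 4 * u) - c1) in HD.
      change (weight p u * (- (PI * u / 8) * cos (PI / 4 * u) / sin (PI / 4 * u))
        + PI / 4 * (weight p u * u) * c2 = - (PI / 8) * (u * weight p u) / sin (PI / 4 * u) * c1).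
      replace c1 with (cos (PI / 4 * u) - 2 * sin (PI / 4 * u) * c2) by lra.
      field; lra.
    + intros k; unfold s, mult; simpl.
      replace (2 * (INR k + 1) * (PI / 4 * u)) with ((INR k + 1) * (PI / 2) * u) by field.
      ring. }
change (is_lim_seq (sum_n S1) (- J)).
apply is_lim_seq_ext with (fun n => RInt (f n) 0 1 - J).
{ intros n; rewrite (is_RInt_unique _ _ _ _ (Hf n)); ring. }
replace (Finite (- J)) with (Finite (0 - J)) by (f_equal; ring).
apply is_lim_seq_minus'; [exact HRL|apply is_lim_seq_const].
Qed.

Theorem theorem4p5 : forall r : nat, (2 <= r)%nat ->
  ex_series (fun k : nat =>
    INR (fact (2 * k)) * (4 * INR r + 2 * INR k - 1) / INR (fact (2 * r + 2 * k))
    * (zeta (2 * INR k) / 4 ^ (2 * k))) /\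
  zeta (2 * INR r + 1) =
  - ((2 ^ (2 * r - 1) - 2) * PI ^ 2
     / (INR r * (2 * INR r - 1) * (2 ^ (4 * r + 1) + 2 ^ (2 * r) - 1)))
    * zeta (2 * INR r - 1)
  + 2 ^ (4 * r + 1)
    / (INR r * (2 * INR r - 1) * (2 ^ (4 * r + 1) + 2 ^ (2 * r) - 1))
    * (sum_n_m (fun k : nat =>
         (-1) ^ (k - 1)
         * ((INR r - INR k) * (2 * INR r + 2 * INR k - 1) / INR (fact (2 * k)))
         * (PI / 2) ^ (2 * k) * zeta (2 * INR r + 1 - 2 * INR k)) 1 (r - 1)
       + (-1) ^ r * (PI / 2) ^ (2 * r)
         * Series (fun k : nat =>
             INR (fact (2 * k)) * (4 * INR r + 2 * INR k - 1)
             / INR (fact (2 * r + 2 * k)) * (zeta (2 * INR k) / 4 ^ (2 * k)))).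
Proof.
intros r Hr; destruct r as [|q]; [lia|].
assert (Hq : (1 <= q)%nat) by lia.
pose proof PI_RGT_0; pose proof (le_INR 1 q Hq) as HqR; simpl in HqR.
set (J := RInt (fun u => weight (2 * q) u * PSeries zeta_even_coef (u ^ 2)) 0 1).
assert (HJ : is_series (fun k : nat =>
    INR (fact (2 * k)) * (4 * INR (S q) + 2 * INR k - 1) / INR (fact (2 * S q + 2 * k))
    * (zeta (2 * INR k) / 4 ^ (2 * k))) J).
{ apply is_series_Rext with
    (fun k => zeta_even_coef k * RInt (fun u => weight (2 * q) u * u ^ (2 * k)) 0 1).
  - intros k; rewrite (is_RInt_unique _ _ _ _ (is_RInt_weight (2 * q) (2 * k))).
    unfold zeta_even_coef.
    replace (2 * q + 2 * k + 2)%nat with (2 * S q + 2 * k)%nat by lia.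
    rewrite !mult_INR, (S_INR q); simpl (INR 2); unfold Rdiv; ring.
  - apply is_series_RInt_PSeries; [exact CV_radius_zeta_even_coef|].
    intros u _; apply continuous_weight. }
split; [exists J; exact HJ|].
rewrite (is_series_unique _ _ HJ).
(* [E1] and [E2] evaluate the same series, once as [- J] and once through zeta values. *)
pose proof (RInt_weight_zeta_even q) as E1; cbv zeta in E1; fold J in E1.
pose proof (is_series_Rmult_l (PI / 4) _ _ (is_series_sin_moment_combination q Hq)) as E2.
apply is_series_unique in E1; apply is_series_unique in E2.
rewrite E1 in E2; clear E1 HJ.
set (h := PI / 2) in *.
set (A := 2 * INR (S q) * (2 * INR (S q) - 1)) in *.
replace (S q - 1)%nat with q by lia.
set (F := sum_n_m _ 1 q) in E2; set (G := sum_n_m _ 1 q).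
(* With r = q + 1, A - 2k (2k-1) = 2 (r-k) (2r+2k-1); the sign is the shift from (-1)^k to
   (-1)^(k-1). *)
assert (HFG : F = -2 * G).
{ unfold F, G; rewrite <- sum_n_m_Rmult_l; apply sum_n_m_ext_loc; intros k Hk.
  replace (INR (2 * q + 3 - 2 * k)) with (2 * INR (S q) + 1 - 2 * INR k).
  - destruct k as [|k]; [lia|]; simpl (S k - 1)%nat; rewrite Nat.sub_0_r.
    rewrite <- (tech_pow_Rmult (-1)); match goal with |- ?x = ?y => change (@eq R x y) end.
    unfold A, Rdiv; ring.
  - rewrite minus_INR, plus_INR, !mult_INR, S_INR by lia; simpl; ring. }
rewrite HFG in E2; clear HFG; clearbody F G.
replace (INR (2 * q + 3)) with (2 * INR (S q) + 1) in E2
  by (rewrite plus_INR, mult_INR, S_INR; simpl; ring).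
replace (INR (2 * q + 1)) with (2 * INR (S q) - 1) in E2
  by (rewrite plus_INR, mult_INR, S_INR; simpl; ring).
set (X := zeta (2 * INR (S q) + 1)) in *; set (Y := zeta (2 * INR (S q) - 1)) in *.
(* The factor 1/2 is [PI / 4] divided by the one power of [h] in excess of [2 * S q]. *)
assert (HhJ : (-1) ^ S q * h ^ (2 * S q) * J =
  / 2 * (A * X + -2 * G - h ^ 2 * - (/ 2 ^ (2 * q + 1) * (1 - 2 / 2 ^ (2 * q + 1)) * Y)
         - A * - (/ 2 ^ (2 * q + 3) * (1 - 2 / 2 ^ (2 * q + 3)) * X))).
{ set (T := A * X + _ - _ - _) in *.
  assert (Hs : (-1) ^ q * (-1) ^ q = 1).
  { rewrite <- Rpow_mult_distr; replace (-1 * -1) with 1 by ring; apply pow1. }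
  assert (Hhp : h ^ (2 * S q) <> 0) by (apply pow_nonzero; unfold h; lra).
  replace (h ^ (2 * q + 3)) with (h ^ (2 * S q) * h) in E2
    by (replace (2 * q + 3)%nat with (S (2 * S q)) by lia; simpl; ring).
  replace J with (- (PI / 4 * ((-1) ^ q / (h ^ (2 * S q) * h) * T))) by lra.
  rewrite <- (tech_pow_Rmult (-1)).
  transitivity ((-1) ^ q * (-1) ^ q * (/ 2 * T)); [|rewrite Hs; ring].
  unfold h in *; field; lra. }
rewrite HhJ; clear E2 HhJ.
(* All powers of 2 become monomials in [t]: the large denominator factor is 32 t^2 + 4 t - 1,
   nonzero since [1 <= t], and the goal is a rational identity linear in [X], [Y] and [G]. *)
set (t := 2 ^ (2 * q)).
assert (Ht : 1 <= t) by (apply pow_R1_Rle; lra).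
replace (2 * S q - 1)%nat with (2 * q + 1)%nat by lia.
replace (4 * S q + 1)%nat with (2 * q + (2 * q + 5))%nat by lia.
replace (2 * S q)%nat with (2 * q + 2)%nat by lia.
rewrite !pow_add; fold t.
unfold A, h; rewrite S_INR; field.
repeat split; nra.
Qed.
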